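(* Let $d\ge1$. The competitive ratio of DoubleCoverage for the $k$-taxi problem on weighted trees of combinatorial depth $d$ is at most $4d-1$ if $k=2$, and at most $\frac{2k(k-1)^d-3k+2}{k-2}$ if $k\ge3$.
   Context: The $k$-taxi problem: given a metric space, $k$ servers start at given points; requests $(s_t,d_t)$ arrive online; to serve one, an algorithm moves some server to $s_t$ (if none is there), paying the distance traveled, and then relocates a server at $s_t$ to $d_t$ at no cost; the cost is the total distance traveled excluding relocations. ALG is $c$-competitive (competitive ratio at most $c$) on a class of metrics if for each metric and initial configuration there is a constant $a$ with $\mathrm{ALG}(\sigma)\le c\,\mathrm{OPT}(\sigma)+a$ for all request sequences $\sigma$. A weighted tree is a tree with positive edge weights; its points are its vertices, distance = weighted path length. It has combinatorial depth $d$ if, for some choice of root, every vertex is at most $d$ edges from the root. DoubleCoverage (DC): to bring a server to requested vertex $s$, all unobstructed servers (no other server on their path to $s$; among co-located servers only one counts) move toward $s$ at equal speed until one reaches $s$, a server becoming obstructed stops; then a server is relocated from $s_t$ to $d_t$. *)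

(* Defs.v *)
From HB Require Import structures.
From mathcomp Require Import all_boot all_order all_algebra.
From mathcomp Require Import boolp classical_sets reals.

Set Implicit Arguments.
Unset Strict Implicit.
Unset Printing Implicit Defensive.
Import Order.TTheory GRing.Theory Num.Theory.
Local Open Scope ring_scope.

Definition simple_path (T : eqType) (e : rel T) (x y : T) (p : seq T) : Prop :=
  [/\ path e x p, last x p = y & uniq (x :: p)].

(* The vertex set may be infinite; values of [weight] off the edges are
   irrelevant. *)
Record weighted_tree (R : realType) := WeightedTree {
  vertex :> choiceType;
  adj : rel vertex;
  weight : vertex -> vertex -> R;
  adj_sym : symmetric adj;
  adj_irrefl : irreflexive adj;
  adj_tree : forall x y, exists! p, simple_path adj x y p;
  weight_sym : forall x y, weight x y = weight y x;
  weight_gt0 : forall x y, adj x y -> 0 < weight x y }.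

Arguments adj {R} _.
Arguments weight {R} _.

Definition combinatorial_depth (R : realType) (d : nat) (T : weighted_tree R) :=
  exists r : T, forall v : T,
    exists p, [/\ path (adj T) r p, last r p = v & (size p <= d)%N].

Section TreeMetric.
Variables (R : realType) (T : weighted_tree R).

Fixpoint walk_length (x : T) (p : seq T) : R :=
  if p is y :: p' then weight T x y + walk_length y p' else 0.

Definition tree_path (x y : T) : seq T :=
  xget [::] [set p | simple_path (adj T) x y p].

Definition dist (x y : T) : R := walk_length x (tree_path x y).

(* Points of the tree regarded as a one-dimensional continuum, on which the
   servers of DoubleCoverage move. [Inner u v t] lies on the edge uv at distance
   t from u, so [Inner u v t] and [Inner v u (weight u v - t)] represent the
   same point: sameness of points is [pdist _ _ = 0]. Vertices have a unique
   representation. *)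
Inductive point :=
| Vertex of T
| Inner (u v : T) (t : R) of adj T u v & 0 < t < weight T u v.

Definition pdist (p q : point) : R :=
  match p, q with
  | Vertex x, Vertex y => dist x y
  | Vertex x, Inner u v t _ _ | Inner u v t _ _, Vertex x =>
      Num.min (dist x u + t) (dist x v + (weight T u v - t))
  | Inner u v t _ _, Inner u' v' t' _ _ =>
      if (u == u') && (v == v') then `|t - t'|
      else if (u == v') && (v == u') then `|t - (weight T u v - t')|
      else Num.min
        (Num.min (t + dist u u' + t')
                 (t + dist u v' + (weight T u' v' - t')))
        (Num.min (weight T u v - t + dist v u' + t')
                 (weight T u v - t + dist v v' + (weight T u' v' - t')))
  end.

(* In a tree, the points of the path from p to q are exactly those for which
   the triangle inequality is an equality. *)
Definition on_path (p q r : point) : Prop := pdist p r + pdist r q = pdist p q.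

End TreeMetric.

(* Runs of the k-taxi problem: [X] is the set of possible server positions, [at_]
   locates request points in [X], and [serve s P Q c] says that the algorithm may
   react to a request at s in configuration P by moving its servers to Q at total
   cost c. [taxi_run P sigma c]: starting from P, the request sequence sigma may
   be served at total cost c; relocations are free. *)
Section Taxi.
Variables (R : realType) (V X : Type) (k : nat) (at_ : V -> X).
Variable serve : V -> ('I_k -> X) -> ('I_k -> X) -> R -> Prop.

Definition relocate (P : 'I_k -> X) (i : 'I_k) (x : X) : 'I_k -> X :=
  fun j => if j == i then x else P j.

Inductive taxi_run : ('I_k -> X) -> seq (V * V) -> R -> Prop :=
| taxi_nil P : taxi_run P [::] 0
| taxi_cons P Q i s d sigma c c' :
    serve s P Q c -> Q i = at_ s ->
    taxi_run (relocate Q i (at_ d)) sigma c' ->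
    taxi_run P ((s, d) :: sigma) (c + c').

End Taxi.

Section Offline.
Variables (R : realType) (T : weighted_tree R) (k : nat).

(* An offline solution may move any of its servers to any vertices; that some
   server ends up at the request is imposed by [taxi_run]. *)
Definition offline_serve (s : T) (P Q : 'I_k -> T) (c : R) : Prop :=
  c = \sum_(i < k) dist (P i) (Q i).

Definition OPT (P : 'I_k -> T) (sigma : seq (T * T)) : R :=
  inf [set c | taxi_run id offline_serve P sigma c].

End Offline.

Section DoubleCoverage.
Variables (R : realType) (T : weighted_tree R) (k : nat).
Implicit Types (s : T) (P Q : 'I_k -> point T).

(* Among co-located servers, the one of least index is the one that counts. *)
Definition unobstructed s P (i : 'I_k) : Prop :=
  forall j, j != i -> on_path (P i) (Vertex s) (P j) ->
    pdist (P i) (P j) = 0 /\ (i < j)%N.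

(* Q arises from P by moving the servers unobstructed in P by h towards s. *)
Definition advance s (h : R) P Q : Prop :=
  forall i,
    (unobstructed s P i ->
       on_path (P i) (Vertex s) (Q i) /\ pdist (P i) (Q i) = h) /\
    (~ unobstructed s P i -> Q i = P i).

(* A period of duration h of the continuous motion, strictly before the end of
   which no server is at s and the set of unobstructed servers is constant. *)
Definition dc_phase s (h : R) P Q : Prop :=
  [/\ 0 < h, advance s h P Q &
      forall h' P', 0 <= h' < h -> advance s h' P P' ->
        forall i, P' i <> Vertex s /\
                  (unobstructed s P' i <-> unobstructed s P i)].

Inductive dc_serve s : ('I_k -> point T) -> ('I_k -> point T) -> R -> Prop :=
| dc_stop P i : P i = Vertex s -> dc_serve s P P 0
| dc_step h P Q P' c :
    dc_phase s h P Q -> dc_serve s Q P' c ->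
    dc_serve s P P' (\sum_(i < k) pdist (P i) (Q i) + c).

Definition dc_run := taxi_run (@Vertex R T) dc_serve.

End DoubleCoverage.

(* DoubleCoverage is c-competitive for k servers on a class of weighted trees.
   As its runs are given by a relation, it is also required that a run exists. *)
Definition DC_competitive (R : realType) (k : nat)
    (class : weighted_tree R -> Prop) (c : R) : Prop :=
  forall T : weighted_tree R, class T -> forall C0 : 'I_k -> T,
  exists a : R, forall sigma : seq (T * T),
    let ALG x := dc_run (fun i => Vertex (C0 i)) sigma x in
    (exists x, ALG x) /\ (forall x, ALG x -> x <= c * OPT C0 sigma + a).

(* Main.v *)
Require Import Defs.
From mathcomp Require Import all_boot all_order all_algebra.
From mathcomp Require Import boolp classical_sets reals.
From mathcomp Require Import perm ring lra zify.
Import Order.TTheory GRing.Theory Num.Theory.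
Local Open Scope ring_scope.

Set Implicit Arguments.
Unset Strict Implicit.
Unset Printing Implicit Defensive.

(* Fix a root of depth at most d. The potential is the minimum over matchings of
   DoubleCoverage's servers with the offline servers of the sum of asymmetric
   distances: a unit of length on an edge at level l costs S - b_l when the path
   from the DoubleCoverage server to the offline server goes up, and b_l when it
   goes down. Up to a difference of two sums over configurations this is S/2 times
   the cost of a matching in the tree metric, so relocating two servers matched
   at distance 0 does not change it. An offline move raises it by at most S - 1 per
   unit.

   While DoubleCoverage moves, one moving server is matched with the offline
   server at the request. If all n movers go up, the potential changes at rate at
   most -S + n b_1. If one goes down at level l, all others are below it, at
   levels at least l + 1, and the rate is at most -b_l + (n - 1) b_(l+1). These
   rates pay for the cost n if b_d = 1, b_l = (k - 1) b_(l+1) + k and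
   S = k (b_1 + 1); then S - 1 is the claimed ratio.

   A run exists because the set of unobstructed servers never grows, so that each
   phase can last until this set shrinks or the request is reached.

   To compute with points of the tree we embed it in a coordinate space with one
   coordinate per edge, where the metric is the l1 distance. *)

(** * Paths to the root, ancestors and levels *)

Section RootedTree.
Variables (R : realType) (T : weighted_tree R) (r : T).
Implicit Types x y z u v : T.

Lemma tree_pathP x y : simple_path (adj T) x y (tree_path x y).
Proof.
have [p [hp _]] := adj_tree x y.
by rewrite /tree_path; case: xgetP => [q _ //|/(_ p)].
Qed.

Lemma tree_path_unique x y p : simple_path (adj T) x y p -> tree_path x y = p.
Proof.
have [q [_ hq]] := adj_tree x y.
by move=> hp; rewrite -(hq _ hp) -(hq _ (tree_pathP x y)).
Qed.

Lemma tree_path_refl x : tree_path x x = [::].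
Proof. exact: tree_path_unique. Qed.

(** If [x] is not on the path from [y] to [z], prepending it gives a simple path. If it is,
    uniqueness makes the part of that path from [y] to [x] the single edge, so [x] comes first on
    it. *)
Lemma tree_path_adj x y z : adj T x y ->
  tree_path x z = y :: tree_path y z \/ tree_path y z = x :: tree_path x z.
Proof.
move=> exy; have [hp hl hu] := tree_pathP y z.
case: (boolP (x \in tree_path y z)) => [xin|xnin]; last first.
  left; apply: tree_path_unique; split=> //=; first by rewrite exy.
  move: hu => /= ->; rewrite inE negb_or xnin andbT andbT.
  by apply: contraTN exy => /eqP ->; rewrite adj_irrefl.
right; move: hp hl hu; case/splitPr: xin => p1 p2 hp hl hu.
have p1nil : p1 = [::].
  have : tree_path y x = rcons p1 x.
    apply: tree_path_unique; split; rewrite ?last_rcons //.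
      by move: hp; rewrite -cat_rcons cat_path => /andP[].
    by move: hu; rewrite -cat_rcons -cat_cons cat_uniq => /andP[].
  have -> : tree_path y x = [:: x].
    apply: tree_path_unique; split=> //=; first by rewrite adj_sym exy.
    rewrite inE andbT; apply: contraTN exy => /eqP ->.
    by rewrite adj_irrefl.
  by case: p1 {hp hl hu} => // a [].
move: hp hl hu; rewrite p1nil /= => /andP[_ hp] hl /andP[_ hu].
by congr cons; apply/esym; apply: tree_path_unique; split.
Qed.

Definition parent x : T := head r (tree_path x r).
Definition level x : nat := size (tree_path x r).
Definition ancestors x : seq T := x :: tree_path x r.

Lemma tree_path_parent x : x != r ->
  adj T x (parent x) /\ tree_path x r = parent x :: tree_path (parent x) r.
Proof.
have := tree_pathP x r; rewrite /parent.
case e: (tree_path x r) => [|y p] [hp hl hu] /= xr.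
  by rewrite -hl /= eqxx in xr.
move: hp hl hu => /= /andP[exy hp] hl /andP[_ hu]; split=> //.
by congr cons; apply/esym; apply: tree_path_unique; split.
Qed.

Lemma ancestors_root : ancestors r = [:: r].
Proof. by rewrite /ancestors tree_path_refl. Qed.

Lemma ancestors_parent x : x != r -> ancestors x = x :: ancestors (parent x).
Proof. by rewrite /ancestors => /tree_path_parent[_ {1}->]. Qed.

Lemma in_ancestors x v : x != r ->
  (v \in ancestors x) = (v == x) || (v \in ancestors (parent x)).
Proof. by move/ancestors_parent->; rewrite in_cons. Qed.

Lemma level_parent x : x != r -> level x = (level (parent x)).+1.
Proof. by rewrite /level => /tree_path_parent[_ {1}->]. Qed.

Lemma level_gt0 x : x != r -> (0 < level x)%N.
Proof. by move/level_parent->. Qed.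

Lemma adj_parent x y : adj T x y ->
  (x != r /\ parent x = y) \/ (y != r /\ parent y = x).
Proof.
by move=> /(tree_path_adj r)[] e; [left|right];
  (split; [apply/eqP => er; rewrite er tree_path_refl in e|rewrite /parent e]).
Qed.

Lemma ancestors_uniq x : uniq (ancestors x).
Proof. by have [] := tree_pathP x r. Qed.

Lemma ancestors_refl x : x \in ancestors x.
Proof. by rewrite inE eqxx. Qed.

Lemma root_ancestor x : r \in ancestors x.
Proof. by have [_ e _] := tree_pathP x r; rewrite -[X in X \in _]e mem_last. Qed.

Lemma ancestors_ind (P : T -> Prop) :
  P r -> (forall x, x != r -> P (parent x) -> P x) -> forall x, P x.
Proof.
move=> hr hs x; move: {2}(level x) (erefl (level x)) => n.
elim: n x => [|n IH] x hx; case: (eqVneq x r) => [->//|xr].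
  by have := level_gt0 xr; rewrite hx.
by apply: hs => //; apply: IH; move: hx; rewrite level_parent // => -[].
Qed.

Lemma ancestors_suffix x u :
  u \in ancestors x -> exists s, ancestors x = s ++ ancestors u.
Proof.
elim/ancestors_ind: x u => [|x xr IH] u.
  by rewrite ancestors_root inE => /eqP ->; exists [::]; rewrite ancestors_root.
rewrite in_ancestors // => /predU1P[->|/IH[s e]]; first by exists [::].
by exists (x :: s); rewrite ancestors_parent // e.
Qed.

Lemma ancestors_trans x u v :
  v \in ancestors u -> u \in ancestors x -> v \in ancestors x.
Proof. by move=> vu /ancestors_suffix[s ->]; rewrite mem_cat vu orbT. Qed.

Lemma ancestors_level x u : u \in ancestors x -> u != x -> (level u < level x)%N.
Proof.
move=> /ancestors_suffix[[|a s] e] ux.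
  by case: e ux => -> _; rewrite eqxx.
by move: (congr1 size e); rewrite size_cat /= /level; lia.
Qed.

Lemma ancestors_anti u v : u \in ancestors v -> v \in ancestors u -> u = v.
Proof.
move=> uv vu; apply/eqP; apply: contraT => ne.
have := ancestors_level uv ne; rewrite eq_sym in ne.
by have := ancestors_level vu ne; lia.
Qed.

Lemma ancestors_total x u v : u \in ancestors x -> v \in ancestors x ->
  u \in ancestors v \/ v \in ancestors u.
Proof.
elim/ancestors_ind: x => [|x xr IH].
  by rewrite ancestors_root !inE => /eqP-> /eqP->; left; apply: root_ancestor.
move=> hu hv; move: (hu) (hv); rewrite !(in_ancestors _ xr).
move=> /predU1P[->|hu'] /predU1P[->|hv']; [left; apply: ancestors_refl|by right|by left|exact: IH].
Qed.

(** Cutting the cycles out of the walk and reversing it gives the tree path from [x] to the root,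
    which is no longer than the walk. *)
Lemma walk_to_root_size d (p : seq T) x :
  path (adj T) r p -> last r p = x -> (size p <= d)%N -> (level x <= d)%N.
Proof.
move=> hp hl hs; apply: leq_trans hs.
case/shortenP: hp hl => p' hp' hu' /allP sub hl.
have -> : level x = size p'.
  rewrite /level (@tree_path_unique x r (rev (belast r p'))).
    by rewrite size_rev size_belast.
  split.
  - by rewrite -hl rev_path; under eq_path do rewrite adj_sym.
  - by case: p' {hp' hu' sub} hl => //= a p' _; rewrite rev_cons last_rcons.
  - by rewrite -hl -rev_rcons -lastI rev_uniq.
apply: (@uniq_leq_size T p' p); [by case/andP: hu' | exact/allP].
Qed.

End RootedTree.

(** * Coordinates indexed by edges and the l1 distance *)

Section Coordinates.
Variables (R : realType) (T : weighted_tree R) (r : T).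
Implicit Types (x y z u v c : T) (p q : Defs.point T) (E : seq T).

Local Notation parent := (parent r).
Local Notation ancestors := (ancestors r).

(** The vertex set may be infinite, so sums run over finite lists that contain the support of the
    summand; this allows the list to be changed. *)
Lemma sum_widen E E' (F : T -> R) : uniq E -> uniq E' ->
  (forall v, F v != 0 -> v \in E /\ v \in E') ->
  \sum_(v <- E) F v = \sum_(v <- E') F v.
Proof.
move=> uE uE' hF.
have aux (A B : seq T) : (forall v, F v != 0 -> v \in B) ->
    \sum_(v <- A) F v = \sum_(v <- [seq v <- A | v \in B]) F v.
  move=> hB; rewrite big_filter [RHS]big_mkcond; apply: eq_bigr => v _.
  by case: ifPn => // vB; apply: contraNeq vB => /hB.
rewrite (aux E E') => [|v /hF[]//]; rewrite [RHS](aux E' E) => [|v /hF[]//].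
apply: perm_big; apply: uniq_perm; rewrite ?filter_uniq // => v.
by rewrite !mem_filter andbC.
Qed.

(** A vertex stands for the edge to its parent. The root stands for no edge, hence the length 0. *)
Definition edge_len v : R := if v == r then 0 else weight T v (parent v).
Definition vcoord x v : R := if v \in ancestors x then edge_len v else 0.

(* [coord p v] is the length of the part of the edge from v to its parent that
   lies on the path from the root to p. *)
Definition coord p v : R :=
  match p with
  | Vertex x => vcoord x v
  | Inner u w t _ _ =>
      vcoord u v + t / weight T u w * (vcoord w v - vcoord u v)
  end.

Definition support p : seq T :=
  match p with
  | Vertex x => ancestors x
  | Inner u w _ _ _ => ancestors u ++ ancestors w
  end.

Definition covers E (f : T -> R) := forall v, f v != 0 -> v \in E.
Definition l1 E (f g : T -> R) : R := \sum_(v <- E) `|f v - g v|.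

Lemma edge_len_gt0 v : v != r -> 0 < edge_len v.
Proof.
rewrite /edge_len => vr; rewrite (negbTE vr).
by apply: weight_gt0; case: (tree_path_parent vr).
Qed.

Lemma edge_len_ge0 v : 0 <= edge_len v.
Proof.
by case: (eqVneq v r) => [->|/edge_len_gt0/ltW//]; rewrite /edge_len eqxx.
Qed.

Lemma vcoord_covers x : covers (ancestors x) (vcoord x).
Proof. by move=> v; rewrite /vcoord; case: ifP; rewrite ?eqxx. Qed.

Lemma coord_covers p : covers (support p) (coord p).
Proof.
case: p => [x|u w t e ht] v; first exact: vcoord_covers.
rewrite /coord /support; apply: contraNT; rewrite mem_cat negb_or /vcoord => /andP[/negbTE-> /negbTE->].
by rewrite subrr mulr0 addr0.
Qed.

Lemma covers_sub E E' f : {subset E <= E'} -> covers E f -> covers E' f.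
Proof. by move=> sub h v /h /sub. Qed.

Lemma l1_widen E E' f g : uniq E -> uniq E' -> covers E f -> covers E g ->
  covers E' f -> covers E' g -> l1 E f g = l1 E' f g.
Proof.
move=> uE uE' Ef Eg Ef' Eg'; apply: sum_widen => // v.
have [fv|fv _] := eqVneq (f v) 0; last by split; [apply: Ef|apply: Ef'].
have [gv|gv _] := eqVneq (g v) 0; last by split; [apply: Eg|apply: Eg'].
by rewrite fv gv subrr normr0 eqxx.
Qed.

Lemma parentN_ancestor c : c != r -> c \notin ancestors (parent c).
Proof.
by move=> cr; have := ancestors_uniq r c; rewrite (ancestors_parent cr) => /andP[].
Qed.

Lemma parent_neq c : c != r -> parent c == c = false.
Proof.
move=> cr; apply/negbTE; apply: contra (parentN_ancestor cr) => /eqP {1}<-.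
exact: ancestors_refl.
Qed.

Lemma parent_cycle c c' : c != r -> c' != r -> parent c = c' -> parent c' = c ->
  c = c'.
Proof.
move=> /level_parent h /level_parent h' e e'.
by move: h h'; rewrite e e'; lia.
Qed.

Lemma vcoord_parent c v : c != r ->
  vcoord (parent c) v = if v == c then 0 else vcoord c v.
Proof.
move=> cr; rewrite /vcoord (in_ancestors _ cr).
by case: eqVneq => [->|//]; rewrite (negbTE (parentN_ancestor cr)).
Qed.

Lemma vcoord_self c : vcoord c c = edge_len c.
Proof. by rewrite /vcoord ancestors_refl. Qed.

Lemma vcoord_cases x v : vcoord x v = 0 \/ vcoord x v = edge_len v.
Proof. by rewrite /vcoord; case: ifP; [right|left]. Qed.

Lemma adj_edge u w : adj T u w -> exists c,
  [/\ c != r, edge_len c = weight T u w &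
      (c = w /\ parent c = u) \/ (c = u /\ parent c = w)].
Proof.
case/(adj_parent r) => -[cr e].
  by exists u; split; rewrite /edge_len ?(negbTE cr) ?e //; right.
exists w; split; rewrite /edge_len ?(negbTE cr) ?e //; last by left.
exact: weight_sym.
Qed.

(** Removes the choice of orientation: [c] is the lower end of the edge and [a] the distance from
    its upper end, so the point has the coordinates of [c] with the last one cut to [a]. *)
Lemma coord_inner u w t e ht : exists c a,
  [/\ c != r, 0 < a < edge_len c, edge_len c = weight T u w,
      (c = w /\ parent c = u /\ a = t) \/
      (c = u /\ parent c = w /\ a = weight T u w - t) &
      forall v, coord (@Inner R T u w t e ht) v = if v == c then a else vcoord c v].
Proof.
have [c [cr ce cuw]] := adj_edge e.
have W0 : weight T u w != 0 by rewrite gt_eqF // weight_gt0.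
case: cuw => -[cuw pc].
- exists c, t; split=> //; first by rewrite ce.
    by left.
  move=> v /=; rewrite -cuw -pc vcoord_parent // pc cuw; case: eqVneq => [->|_].
    by rewrite -cuw vcoord_self ce -cuw; field; rewrite cuw.
  by rewrite subrr mulr0 addr0.
- exists c, (weight T u w - t); split=> //; first by rewrite ce; lra.
    by right.
  move=> v /=; rewrite -cuw -pc vcoord_parent // pc cuw; case: eqVneq => [->|_].
    by rewrite -cuw vcoord_self ce cuw; field.
  by rewrite subrr mulr0 addr0.
Qed.

(** A common form for both kinds of points; a vertex [x] is the case where the edge of [x] is
    covered entirely. *)
Lemma coord_canon p : exists c a,
  [/\ 0 <= a <= edge_len c, c != r -> 0 < a &
      forall v, coord p v = if v == c then a else vcoord c v].
Proof.
case: p => [x|u w t e ht].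
  exists x, (edge_len x); rewrite edge_len_ge0 lexx; split=> //.
    exact: edge_len_gt0.
  by move=> v /=; case: eqVneq => [->|//]; apply: vcoord_self.
have [c [a [cr ha _ _ hc]]] := coord_inner e ht.
by exists c, a; split=> //; [lra|move=> _; case/andP: ha].
Qed.

(** The extreme values of [a] give the vertices [c] and [parent c], all others an interior point. *)
Lemma canon_coord c a : 0 <= a <= edge_len c ->
  exists p, forall v, coord p v = if v == c then a else vcoord c v.
Proof.
move=> ha; case: (eqVneq a (edge_len c)) => [->|ac].
  by exists (Vertex c) => v /=; case: eqVneq => [->|//]; apply: vcoord_self.
have cr : c != r.
  apply: contraNneq ac => cr; move: ha; rewrite cr /edge_len eqxx.
  by case/andP => a1 a2; rewrite eq_le a1 a2.
case: (eqVneq a 0) => [->|a0].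
  by exists (Vertex (parent c)) => v /=; apply: vcoord_parent.
have [e _] := tree_path_parent cr; rewrite adj_sym in e.
have cE : edge_len c = weight T (parent c) c.
  by rewrite weight_sym /edge_len (negbTE cr).
have ht : 0 < a < weight T (parent c) c.
  by rewrite -cE !lt_neqAle eq_sym a0 ac.
exists (Inner e ht) => v /=; rewrite vcoord_parent //; case: eqVneq => [->|_].
  by rewrite vcoord_self -cE; field; rewrite gt_eqF // edge_len_gt0.
by rewrite subrr mulr0 addr0.
Qed.

(** The subtree below [x] can be entered only through [x]. *)
Lemma walk_avoids x z (s : seq T) : path (adj T) z s -> x \notin z :: s ->
  x \notin ancestors z -> x \notin ancestors (last z s).
Proof.
elim: s z => //= z' s IH z /andP[ezz' hs] xs xz; apply: IH => //.
  by move: xs; rewrite !in_cons !negb_or => /and3P[_ -> ->].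
have xz' : x != z' by apply: contraNneq xs => ->; rewrite !in_cons eqxx orbT.
case: (adj_parent r ezz') => -[nr e].
  by move: xz; rewrite (in_ancestors _ nr) e negb_or => /andP[].
by rewrite (in_ancestors _ nr) e negb_or xz'.
Qed.

(** The subtree below [c] can be left only through the parent of [c]. *)
Lemma walk_stays c z (s : seq T) : c != r -> path (adj T) z s ->
  parent c \notin z :: s -> c \in ancestors z -> c \in ancestors (last z s).
Proof.
move=> cr; elim: s z => //= z' s IH z /andP[ezz' hs] xs xz; apply: IH => //.
  by move: xs; rewrite !in_cons !negb_or => /and3P[_ -> ->].
case: (adj_parent r ezz') => -[nr e]; last first.
  by rewrite (in_ancestors _ nr) e xz orbT.
move: xz; rewrite (in_ancestors _ nr) e => /predU1P[cz|//].
by move: xs; rewrite cz e !in_cons eqxx orbT.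
Qed.

Lemma l1_split E c f g : uniq E -> c \in E ->
  l1 E f g = `|f c - g c| + \sum_(v <- E | v != c) `|f v - g v|.
Proof. by move=> uE cE; rewrite /l1 (bigD1_seq c). Qed.

Lemma l1_change E c f g h : uniq E -> c \in E ->
  (forall v, v != c -> f v = g v) ->
  l1 E f h = l1 E g h - `|g c - h c| + `|f c - h c|.
Proof.
move=> uE cE fg; rewrite !(l1_split _ _ uE cE).
have -> : \sum_(v <- E | v != c) `|f v - h v| = \sum_(v <- E | v != c) `|g v - h v|.
  by apply: eq_bigr => v /fg ->.
by ring.
Qed.

(** The first step changes only the coordinate of the edge crossed. The rest of a simple walk never
    crosses this edge again, so the end point lies on its far side and the l1 distance drops by the
    weight of the edge. *)
Lemma walk_length_l1 x (s : seq T) E : path (adj T) x s -> uniq (x :: s) ->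
  uniq E -> covers E (vcoord x) -> covers E (vcoord (last x s)) ->
  walk_length x s = l1 E (vcoord x) (vcoord (last x s)).
Proof.
elim: s x E => [|z s IH] x E /=.
  by move=> *; rewrite /l1 big1 // => v _; rewrite subrr normr0.
move=> /andP[exz hs] /andP[xs us] uE Ex Ey; set y := last z s in Ey *.
(* [E] need not contain the support of the intermediate vertex [z]. *)
pose E' := undup (E ++ ancestors z).
have uE' : uniq E' by apply: undup_uniq.
have sE : {subset E <= E'} by move=> v; rewrite mem_undup mem_cat => ->.
have Ex' := covers_sub sE Ex; have Ey' := covers_sub sE Ey.
have Ez' : covers E' (vcoord z).
  apply: covers_sub (@vcoord_covers z) => v.
  by rewrite mem_undup mem_cat orbC => ->.
rewrite (l1_widen uE uE') // (IH z E') //.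
case: (adj_parent r exz) => -[nr e].
- have xy : x \notin ancestors y.
    by apply: walk_avoids => //; rewrite -e parentN_ancestor.
  have xE : x \in E' by apply: Ex'; rewrite vcoord_self gt_eqF // edge_len_gt0.
  rewrite (@l1_change E' x (vcoord x) (vcoord z)) // => [|v vx]; last first.
    by rewrite -e vcoord_parent // (negbTE vx).
  have -> : vcoord z x = 0 by rewrite -e vcoord_parent // eqxx.
  have -> : vcoord y x = 0 by rewrite /vcoord (negbTE xy).
  rewrite vcoord_self !subr0 normr0 subr0 ger0_norm ?edge_len_ge0 //.
  by rewrite /edge_len (negbTE nr) e addrC.
- have zy : z \in ancestors y.
    by apply: walk_stays; rewrite ?ancestors_refl ?e.
  have zE : z \in E' by apply: Ez'; rewrite vcoord_self gt_eqF // edge_len_gt0.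
  rewrite (@l1_change E' z (vcoord x) (vcoord z)) // => [|v vx]; last first.
    by rewrite -e vcoord_parent // (negbTE vx).
  have -> : vcoord x z = 0 by rewrite -e vcoord_parent // eqxx.
  have -> : vcoord y z = edge_len z by rewrite /vcoord zy.
  rewrite vcoord_self subrr normr0 subr0 sub0r normrN ger0_norm ?edge_len_ge0 //.
  by rewrite /edge_len (negbTE nr) e weight_sym addrC.
Qed.

Lemma dist_l1 x y E : uniq E -> covers E (vcoord x) -> covers E (vcoord y) ->
  dist x y = l1 E (vcoord x) (vcoord y).
Proof.
move=> uE Ex Ey; have [hp hl hu] := tree_pathP x y.
by rewrite /dist (walk_length_l1 hp hu uE) ?hl.
Qed.

Lemma l1C E f g : l1 E f g = l1 E g f.
Proof. by apply: eq_bigr => v _; rewrite distrC. Qed.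

(** Since [f] lies at one end of coordinate [c], the distance to a point inside this edge is
    realised through that end. This produces the minima in [pdist]. *)
Lemma l1_edge E c a f p : uniq E -> c \in E -> c != r ->
  0 < a < edge_len c -> f c = 0 \/ f c = edge_len c ->
  (forall v, coord p v = if v == c then a else vcoord c v) ->
  l1 E f (coord p) = Num.min (l1 E f (vcoord c) + (edge_len c - a))
                             (l1 E f (vcoord (parent c)) + a).
Proof.
move=> uE cE cr /andP[a0 aw] fc hp.
have e1 v : v != c -> coord p v = vcoord c v by move=> /negbTE vc; rewrite hp vc.
have e2 v : v != c -> vcoord (parent c) v = vcoord c v.
  by move=> /negbTE vc; rewrite vcoord_parent // vc.
rewrite l1C [X in Num.min (X + _)]l1C [X in Num.min _ (X + _)]l1C.
rewrite (l1_change _ uE cE e1) (l1_change _ uE cE e2) hp eqxx vcoord_self.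
rewrite vcoord_parent // eqxx.
have w0 := edge_len_gt0 cr.
case: fc => ->; rewrite ?subr0 ?sub0r ?subrr ?normr0 ?normrN ?(gtr0_norm w0).
  rewrite (gtr0_norm a0) min_r; first by ring.
  by lra.
rewrite ltr0_norm; last by lra.
by rewrite min_l; [ring|lra].
Qed.

Lemma vertex_inner_l1 E x u w t e ht : uniq E -> covers E (vcoord x) ->
  covers E (vcoord u) -> covers E (vcoord w) ->
  pdist (Vertex x) (@Inner R T u w t e ht) =
  l1 E (vcoord x) (coord (Inner e ht)).
Proof.
move=> uE Ex Eu Ew; have [c [a [cr ca cW cuw hc]]] := coord_inner e ht.
have cE : c \in E.
  by case: cuw => -[ec _]; [apply: Ew|apply: Eu];
    rewrite -ec vcoord_self gt_eqF // edge_len_gt0.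
rewrite (l1_edge uE cE cr ca (vcoord_cases x c) hc) /=.
rewrite !(dist_l1 uE) // cW.
case: cuw => -[-> [-> ->]]; first by rewrite [RHS]minC.
by congr (Num.min (_ + _) _); ring.
Qed.

Lemma minrD2r (a b c : R) : Num.min a b + c = Num.min (a + c) (b + c).
Proof. by case: (leP a b) => ab; [rewrite min_l|rewrite min_r]; lra. Qed.

(** On a common edge only one coordinate differs, and the four cases are the orientations of the two
    representations. On different edges, [l1_edge] applied at both points gives the minimum of four
    terms. *)
Lemma inner_inner_l1 E u w t e ht u' w' t' e' ht' : uniq E ->
  covers E (vcoord u) -> covers E (vcoord w) ->
  covers E (vcoord u') -> covers E (vcoord w') ->
  pdist (@Inner R T u w t e ht) (@Inner R T u' w' t' e' ht') =
  l1 E (coord (Inner e ht)) (coord (Inner e' ht')).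
Proof.
move=> uE Eu Ew Eu' Ew'.
have [c [a [cr ca cW cuw hc]]] := coord_inner e ht.
have [c' [a' [cr' ca' cW' cuw' hc']]] := coord_inner e' ht'.
have cE : c \in E.
  by case: cuw => -[ec _]; [apply: Ew|apply: Eu];
    rewrite -ec vcoord_self gt_eqF // edge_len_gt0.
have cE' : c' \in E.
  by case: cuw' => -[ec _]; [apply: Ew'|apply: Eu'];
    rewrite -ec vcoord_self gt_eqF // edge_len_gt0.
have [cc|cc] := eqVneq c c'.
  have -> : l1 E (coord (Inner e ht)) (coord (Inner e' ht')) = `|a - a'|.
    rewrite (l1_split _ _ uE cE) hc hc' cc eqxx big1 ?addr0 // => v vc.
    by rewrite hc hc' cc (negbTE vc) subrr normr0.
  have cW2 : weight T u w = weight T u' w' by rewrite -cW -cW' cc.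
  case: cuw cuw' => -[cu [pu ->]] [] [cu' [pu' ->]] /=.
  - by rewrite -cu -pu -cu' -pu' cc !eqxx.
  - have -> : (u == u') && (w == w') = false.
      by rewrite -pu -cu' cc parent_neq //.
    rewrite -pu -cu -pu' -cu' cc !eqxx /=; congr `|_ - (_ - _)|.
    by rewrite -cu' -pu' -cu -pu cc in cW2.
  - have -> : (u == u') && (w == w') = false.
      by rewrite -pu' -cu cc eq_sym parent_neq //.
    by rewrite -pu -cu -pu' -cu' cc !eqxx /= -normrN; congr `|_|; ring.
  - rewrite -cu -pu -cu' -pu' cc !eqxx /= -normrN; congr `|_|.
    by rewrite -cu' -pu' -cu -pu cc in cW2 *; ring.
have fc' : coord (Inner e ht) c' = 0 \/ coord (Inner e ht) c' = edge_len c'.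
  by rewrite hc eq_sym (negbTE cc); apply: vcoord_cases.
rewrite (l1_edge uE cE' cr' ca' fc' hc').
rewrite [X in Num.min (X + _)]l1C [X in Num.min _ (X + _)]l1C.
rewrite !(l1_edge uE cE cr ca _ hc); try exact: vcoord_cases.
have -> : pdist (Inner e ht) (Inner e' ht') = Num.min
        (Num.min (t + dist u u' + t')
                 (t + dist u w' + (weight T u' w' - t')))
        (Num.min (weight T u w - t + dist w u' + t')
                 (weight T u w - t + dist w w' + (weight T u' w' - t'))).
  rewrite /=.
  have -> : (u == u') && (w == w') = false.
    apply/negP => /andP[/eqP uu /eqP ww]; move/eqP: cc; apply.
    case: cuw cuw' => -[cu [pu _]] [] [cu' [pu' _]]; try congruence;
    by apply: parent_cycle => //; congruence.
  have -> // : (u == w') && (w == u') = false.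
  apply/negP => /andP[/eqP uu /eqP ww]; move/eqP: cc; apply.
  case: cuw cuw' => -[cu [pu _]] [] [cu' [pu' _]]; try congruence;
  by apply: parent_cycle => //; congruence.
rewrite !(dist_l1 uE) // cW cW'.
rewrite [l1 E (vcoord (parent c')) _]l1C [l1 E (vcoord c') (vcoord (parent c))]l1C.
rewrite [l1 E (vcoord c') (vcoord c)]l1C.
rewrite [l1 E (vcoord (parent c')) (vcoord (parent c))]l1C.
rewrite minACA !minrD2r.
case: cuw cuw' => -[-> [-> ->]] [] [-> [-> ->]].
- by rewrite minC; congr (Num.min _ _); rewrite minC; congr (Num.min _ _); ring.
- by congr (Num.min _ _); rewrite minC; congr (Num.min _ _); ring.
- by rewrite minC; congr (Num.min (Num.min _ _) (Num.min _ _)); ring.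
- by congr (Num.min (Num.min _ _) (Num.min _ _)); ring.
Qed.

End Coordinates.

(** * The isometric embedding and the geometry of tree points *)

Section Metric.
Variables (R : realType) (T : weighted_tree R) (r : T).
Implicit Types (z u v c s : T) (p q x y : Defs.point T) (E : seq T).

Local Notation parent := (parent r).
Local Notation ancestors := (ancestors r).
Local Notation edge_len := (edge_len r).
Local Notation vcoord := (vcoord r).
Local Notation coord := (coord r).

(** An interior point has a positive coordinate on its own edge, so its support contains that of
    both ends. *)
Lemma covers_inner E u w t e ht : covers E (coord (@Inner R T u w t e ht)) ->
  covers E (vcoord u) /\ covers E (vcoord w).
Proof.
have [c [a [cr /andP[a0 aw] _ cuw hc]]] := coord_inner r e ht => hE.
have Ec : covers E (vcoord c).
  move=> v vc; apply: hE; rewrite hc; case: (eqVneq v c) => // _.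
  by rewrite gt_eqF.
have Ep : covers E (vcoord (parent c)).
  move=> v; rewrite vcoord_parent //; case: (eqVneq v c) => [_|_ /Ec//].
  by rewrite eqxx.
by case: cuw => -[<- [<- _]].
Qed.

Lemma pdist_l1 E p q : uniq E -> covers E (coord p) -> covers E (coord q) ->
  pdist p q = l1 E (coord p) (coord q).
Proof.
move=> uE; case: p q => [x|u w t e ht] [y|u' w' t' e' ht'].
- exact: dist_l1.
- move=> Ex Eq; have [] := covers_inner Eq.
  exact: vertex_inner_l1.
- move=> Ep Ey; have [] := covers_inner Ep.
  by rewrite l1C => Eu Ew; rewrite -(vertex_inner_l1 e ht uE).
- move=> Ep Eq; have [Eu Ew] := covers_inner Ep; have [] := covers_inner Eq.
  exact: inner_inner_l1.
Qed.

Lemma covers_family (I : finType) (P : I -> Defs.point T) :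
  exists E, uniq E /\ forall i, covers E (coord (P i)).
Proof.
exists (undup (flatten [seq support r (P i) | i <- enum I])).
split=> [|i]; first exact: undup_uniq.
apply: covers_sub (@coord_covers R T r (P i)) => v vi.
rewrite mem_undup; apply/flattenP; exists (support r (P i)) => //.
by apply/mapP; exists i; rewrite ?mem_enum.
Qed.

Lemma covers_seq (ps : seq (Defs.point T)) :
  exists E, uniq E /\ forall i, (i < size ps)%N ->
    covers E (coord (nth (Vertex r) ps i)).
Proof.
have [E [uE hE]] := covers_family (fun i : 'I_(size ps) => nth (Vertex r) ps i).
by exists E; split=> // i hi; apply: (hE (Ordinal hi)).
Qed.

Lemma coord_ge0 p v : 0 <= coord p v.
Proof.
have [c [a [/andP[a0 _] _ ->]]] := coord_canon r p; case: ifP => // _.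
by rewrite /(vcoord _); case: ifP => // _; apply: edge_len_ge0.
Qed.

Lemma coord_le p v : coord p v <= edge_len v.
Proof.
have [c [a [/andP[_ aw] _ ->]]] := coord_canon r p; case: eqVneq => [->//|_].
by rewrite /(vcoord _); case: ifP => // _; apply: edge_len_ge0.
Qed.

(** The path from the root to [p] enters an edge only after traversing all the edges above it. *)
Lemma coord_full p u v : coord p v != 0 -> u \in ancestors v -> u != v ->
  coord p u = edge_len u.
Proof.
have [c [a [/andP[_ aw] _ h]]] := coord_canon r p.
rewrite !h /(vcoord _) => hv uv nuv.
have vc : v \in ancestors c.
  by move: hv; case: (eqVneq v c) => [->|_]; rewrite ?ancestors_refl //; case: ifP; rewrite ?eqxx.
rewrite (ancestors_trans uv vc); case: (eqVneq u c) => // uc.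
move: uv vc nuv; rewrite uc => cv vc.
by rewrite (ancestors_anti cv vc) eqxx.
Qed.

Lemma coord_chain p u v : coord p u != 0 -> coord p v != 0 ->
  u \in ancestors v \/ v \in ancestors u.
Proof.
have [c [a [_ _ h]]] := coord_canon r p.
have aux z : coord p z != 0 -> z \in ancestors c.
  rewrite h /(vcoord _); case: (eqVneq z c) => [->|_]; rewrite ?ancestors_refl //.
  by case: ifP; rewrite ?eqxx.
by move=> /aux uc /aux vc; apply: ancestors_total uc vc.
Qed.

Lemma coord_vertex_in s v : v \in ancestors s -> coord (Vertex s) v = edge_len v.
Proof. by rewrite /= /(vcoord _) => ->. Qed.

Lemma coord_vertex_out s v : v \notin ancestors s -> coord (Vertex s) v = 0.
Proof. by rewrite /= /(vcoord _) => /negbTE->. Qed.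

Lemma pdistC p q : pdist p q = pdist q p.
Proof.
have [E [uE hE]] := covers_seq [:: p; q].
have /= e0 := hE 0%N isT. have /= e1 := hE 1%N isT.
by rewrite !(@pdist_l1 E) // l1C.
Qed.

Lemma pdist_refl p : pdist p p = 0.
Proof.
have [E [uE hE]] := covers_seq [:: p].
have /= e0 := hE 0%N isT.
rewrite (@pdist_l1 E) // /l1 big1 // => v _.
by rewrite subrr normr0.
Qed.

Lemma pdist_ge0 p q : 0 <= pdist p q.
Proof.
have [E [uE hE]] := covers_seq [:: p; q].
have /= e0 := hE 0%N isT. have /= e1 := hE 1%N isT.
by rewrite (@pdist_l1 E) // sumr_ge0.
Qed.

Lemma pdist_triangle p x q : pdist p q <= pdist p x + pdist x q.
Proof.
have [E [uE hE]] := covers_seq [:: p; q; x].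
have /= e0 := hE 0%N isT. have /= e1 := hE 1%N isT. have /= e2 := hE 2%N isT.
rewrite !(@pdist_l1 E) // -big_split.
by apply: ler_sum => v _; apply: ler_distD.
Qed.

(* When [f] is [coord p], these are the coordinates of the points of the path from
   the root to p. *)
Definition segment (f e : T -> R) := forall v,
  0 <= e v <= f v /\ (e v != 0 -> forall u, u \in ancestors v -> u != v -> e u = f u).

(** If each exceeded the other on some edge, these two edges would lie on the root path of [p], one
    above the other. Whichever enters the lower edge is full on the upper one, so it cannot be
    exceeded there. *)
Lemma segment_total p (e e' : T -> R) : segment (coord p) e ->
  segment (coord p) e' -> (forall v, e v <= e' v) \/ (forall v, e' v <= e v).
Proof.
move=> he he'; have [h|] := pselect (forall v, e v <= e' v); first by left.
move=> /existsNP[v /negP]; rewrite -ltNge => vlt; right => u.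
rewrite leNgt; apply/negP => ult.
have [/andP[ev0 evp] fv] := he v; have [/andP[ev0' evp'] fv'] := he' v.
have [/andP[eu0 eup] fu] := he u; have [/andP[eu0' eup'] fu'] := he' u.
have uv : u != v by apply: contraTneq ult => ->; rewrite -leNgt ltW.
case: (@coord_chain p u v); [by rewrite gt_eqF //; lra|by rewrite gt_eqF //; lra| |] => c.
- by rewrite (fv _ u c uv) in ult; [lra|rewrite gt_eqF //; lra].
- by rewrite (fu' _ v c) in vlt; [lra|rewrite gt_eqF //; lra|rewrite eq_sym].
Qed.

Lemma segment_trans f g e : segment f g -> segment g e -> segment f e.
Proof.
move=> fg ge v; have [/andP[g0 gf] h] := fg v.
have [/andP[e0 eg] h'] := ge v; split; first by lra.
move=> ev u uv nuv; rewrite (h' ev _ uv nuv) h //.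
by rewrite gt_eqF // (lt_le_trans _ eg) // lt_neqAle eq_sym ev.
Qed.

Lemma ler_normN (a : R) : - a <= `|a|.
Proof. by rewrite -normrN ler_norm. Qed.

(** For coordinates of two points, these are the coordinates of the point where their root paths
    part. *)
Definition minf (f g : T -> R) v := Num.min (f v) (g v).

Lemma segment_min p q : segment (coord p) (minf (coord p) (coord q)).
Proof.
move=> v; rewrite /minf le_min !coord_ge0 ge_min lexx; split=> // h u uv nuv.
have hp : coord p v != 0.
  by apply: contra h => /eqP->; rewrite min_l ?coord_ge0.
have hq : coord q v != 0.
  by apply: contra h => /eqP->; rewrite min_r ?coord_ge0.
by rewrite (coord_full hp uv nuv) (coord_full hq uv nuv) minxx.
Qed.

(** For a point this is the distance from the root; for [minf] of two points it is their Gromov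
    product based at the root. *)
Definition mass E (f : T -> R) : R := \sum_(v <- E) f v.

Lemma l1_mass E f g : l1 E f g = mass E f + mass E g - 2 * mass E (minf f g).
Proof.
rewrite /mass mulr_sumr -big_split -sumrB /=; apply: eq_bigr => v _.
rewrite /minf; case: (leP (f v) (g v)) => h.
  by rewrite distrC ger0_norm; lra.
by rewrite ger0_norm; lra.
Qed.

Lemma mass_le E f g : (forall v, f v <= g v) -> mass E f <= mass E g.
Proof. by move=> h; apply: ler_sum. Qed.

Lemma minfC f g : minf f g = minf g f.
Proof. by apply: funext => v; rewrite /minf minC. Qed.

(** Both branch points lie on the root path of [q], hence are comparable, and the one nearer to the
    root lies on the root paths of [p] and [x] too. *)
Lemma mass_min_ultra E p q x :
  Num.min (mass E (minf (coord p) (coord q))) (mass E (minf (coord q) (coord x)))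
    <= mass E (minf (coord p) (coord x)).
Proof.
have h1 : segment (coord q) (minf (coord p) (coord q)).
  by rewrite minfC; apply: segment_min.
have h2 := @segment_min q x.
rewrite ge_min; case: (segment_total h1 h2) => h; apply/orP; [left|right];
  apply: mass_le => v; rewrite /minf le_min.
- by rewrite ge_min lexx /= (le_trans (h v)) // /minf ge_min lexx orbT.
- by rewrite (le_trans (h v)) /minf ?ge_min ?lexx ?orbT.
Qed.

(** The four-point condition of tree metrics. Written with masses, the distances from the root
    cancel, and what remains follows from the ultrametric inequality for Gromov products. *)
Lemma four_point p q x y :
  pdist p q + pdist x y <=
  Num.max (pdist p x + pdist q y) (pdist p y + pdist q x).
Proof.
have [E [uE hE]] := covers_seq [:: p; q; x; y].
have /= e0 := hE 0%N isT. have /= e1 := hE 1%N isT. have /= e2 := hE 2%N isT. have /= e3 := hE 3%N isT.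
rewrite !(@pdist_l1 E) // !l1_mass.
pose G a b := mass E (minf (coord a) (coord b)).
have GC a b : G a b = G b a by rewrite /G minfC.
have U a b o : G a b <= G a o \/ G b o <= G a o.
  by have := mass_min_ultra E a b o; rewrite ge_min => /orP.
rewrite -!/(G _ _) le_max; apply/orP.
have a1 := U p x q; have a2 := U p y q; have a3 := U q x p; have a4 := U q y p.
have b1 := U x p y; have b2 := U x q y; have b3 := U y p x; have b4 := U y q x.
rewrite (GC q p) (GC x p) (GC x q) (GC y p) (GC y q) (GC y x) in a1 a2 a3 a4 b1 b2 b3 b4 *.
lra.
Qed.

(** Climb towards the root until the parent is at distance less than [m] from the root, then shorten
    the last edge. *)
Lemma truncate_canon c a E m (f : T -> R) : 0 <= a <= edge_len c ->
  (forall v, f v = if v == c then a else vcoord c v) -> uniq E -> covers E f ->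
  0 <= m <= mass E f ->
  exists x, segment f (coord x) /\ mass E (coord x) = m.
Proof.
move=> ha hf uE; elim/(ancestors_ind (r := r)): c a f m ha hf => [|c cr IH] a f m ha hf Ef hm.
  have f0 v : f v = 0.
    rewrite hf /(vcoord _) ancestors_root inE.
    move: ha; rewrite /(edge_len _) eqxx; case: eqVneq => // _.
    by case/andP => a0 a1; apply/le_anti/andP.
  have x0 v : coord (Vertex r) v = 0.
    by rewrite /= /(vcoord _) ancestors_root inE /(edge_len _); case: eqVneq.
  have -> : m = 0.
    by move: hm; rewrite /mass big1 // => h; apply/le_anti; rewrite andbC.
  exists (Vertex r); split=> [v|]; first by rewrite x0 f0 lexx eqxx.
  by rewrite /mass big1.
have gp : segment f (vcoord (parent c)).
  move=> v; rewrite vcoord_parent // hf; split.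
    case: eqVneq => _; first by rewrite lexx; case/andP: ha.
    by rewrite lexx andbT (coord_ge0 (Vertex c)).
  case: (eqVneq v c) => [_|vc h u uv nuv]; first by rewrite eqxx.
  have vC : v \in ancestors c.
    by move: h; rewrite /(vcoord _); case: ifP; rewrite ?eqxx.
  have uc : u == c = false.
    apply/negbTE; apply: contra nuv => /eqP uc; rewrite uc in uv *.
    by rewrite (ancestors_anti uv vC).
  by rewrite vcoord_parent // hf uc.
have Eg : covers E (vcoord (parent c)).
  move=> v; have [/andP[g0 gf] _] := gp v => gv; apply: Ef.
  by rewrite gt_eqF // (lt_le_trans _ gf) // lt_neqAle eq_sym gv.
have gpf v : vcoord (parent c) v =
    if v == parent c then edge_len (parent c) else vcoord (parent c) v.
  by case: eqVneq => // ->; rewrite vcoord_self.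
case: (leP m (mass E (vcoord (parent c)))) => mg.
  have [||x [sx mx]] := IH (edge_len (parent c)) _ m _ gpf Eg.
  - by rewrite edge_len_ge0 lexx.
  - by case/andP: hm => -> _.
  - by exists x; split=> //; apply: segment_trans sx.
pose a' := m - mass E (vcoord (parent c)).
(* Otherwise [E] would not see the edge of [c], and [f] would have the same mass as the parent,
   which is less than [m]. *)
have cE : c \in E.
  apply: contraLR mg => cE; rewrite -leNgt (_ : mass E _ = mass E f); first by case/andP: hm.
  apply: eq_big_seq => v vE; rewrite vcoord_parent // hf.
  by case: eqVneq vE => // ->; rewrite (negbTE cE).
have split_mass b (g : T -> R) : (forall v, g v = if v == c then b else vcoord c v) ->
    mass E g = b + mass E (vcoord (parent c)).
  move=> hg; rewrite /mass !(bigD1_seq c) //= hg vcoord_parent // eqxx add0r.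
  congr (_ + _); apply: eq_bigr => v vc.
  by rewrite hg vcoord_parent // (negbTE vc).
have ha' : 0 <= a' <= a by rewrite /a'; move: hm; rewrite (split_mass a) //; lra.
have [|x hx] := @canon_coord R T r c a'; first by lra.
exists x; split; last by rewrite (split_mass _ _ hx) /a'; ring.
move=> v; split.
  rewrite hx hf; case: eqVneq => _ //.
  by rewrite lexx andbT (coord_ge0 (Vertex c)).
move=> xv u uv nuv; rewrite (coord_full xv uv nuv) hf.
have vC : v \in ancestors c.
  move: xv; rewrite hx; case: (eqVneq v c) => [->|_]; first by rewrite ancestors_refl.
  by rewrite /(vcoord _); case: ifP; rewrite ?eqxx.
have uc : u == c = false.
  apply/negbTE; apply: contra nuv => /eqP uc; rewrite uc in uv *.
  by rewrite (ancestors_anti uv vC).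
by rewrite uc /(vcoord _) (ancestors_trans uv vC).
Qed.

Lemma truncate p E m : uniq E -> covers E (coord p) -> 0 <= m <= mass E (coord p) ->
  exists x, segment (coord p) (coord x) /\ mass E (coord x) = m.
Proof.
by have [c [a [ha _ hp]]] := coord_canon r p; apply: truncate_canon ha hp.
Qed.

Lemma covers_segment E f e : segment f e -> covers E f -> covers E e.
Proof.
move=> fe Ef v ev; have [/andP[e0 ef] _] := fe v; apply: Ef.
by rewrite gt_eqF // (lt_le_trans _ ef) // lt_neqAle eq_sym ev.
Qed.

Lemma minf_idl f g : (forall v, f v <= g v) -> minf f g = f.
Proof. by move=> h; apply: funext => v; rewrite /minf min_l. Qed.

(** A point on the root path of [p] that is not above the branch point with [q] has the same branch
    point with [q], so it lies between [p] and [q]. *)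
Lemma truncate_between E p q x : uniq E -> covers E (coord p) -> covers E (coord q) ->
  segment (coord p) (coord x) -> mass E (minf (coord p) (coord q)) <= mass E (coord x) ->
  pdist p x = mass E (coord p) - mass E (coord x) /\
  pdist x q = pdist p q - (mass E (coord p) - mass E (coord x)).
Proof.
move=> uE Ep Eq px hm.
have Ex := covers_segment px Ep.
have xp v : coord x v <= coord p v by case: (px v) => /andP[].
rewrite !(pdist_l1 uE) // !l1_mass (minfC (coord p) (coord x)) (minf_idl xp).
split; first by ring.
have aux : mass E (minf (coord x) (coord q)) <= mass E (minf (coord p) (coord q)).
  apply: mass_le => v; rewrite /minf le_min ge_min (xp v) /= ge_min lexx.
  by rewrite orbT.
suff : mass E (minf (coord p) (coord q)) <= mass E (minf (coord x) (coord q)) by lra.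
case: (segment_total px (@segment_min p q)) => h.
  rewrite (@minf_idl (coord x)) // => v; apply: le_trans (h v) _.
  by rewrite /minf ge_min lexx orbT.
by apply: mass_le => v; rewrite {2}/minf le_min h /minf ge_min lexx orbT.
Qed.

(** The path climbs from [p] to the branch point, at distance [M] from the root, and then descends
    to [q]. The point sought is a truncation of [p] in the first part and of [q] in the second. *)
Lemma intermediate p q h : 0 <= h <= pdist p q ->
  exists x, on_path p q x /\ pdist p x = h.
Proof.
have [E [uE hE]] := covers_seq [:: p; q].
have /= Ep := hE 0%N isT; have /= Eq := hE 1%N isT.
rewrite (pdist_l1 uE) // l1_mass => hh.
set M := mass E (minf (coord p) (coord q)) in hh.
have M0 : 0 <= M by apply: sumr_ge0 => v _; rewrite /minf le_min !coord_ge0.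
have Mq : M <= mass E (coord q).
  by apply: mass_le => v; rewrite /minf ge_min lexx orbT.
have Mp : M <= mass E (coord p) by apply: mass_le => v; rewrite /minf ge_min lexx.
case: (leP h (mass E (coord p) - M)) => hM.
  have [|x [px mx]] := @truncate p E (mass E (coord p) - h) uE Ep; first by lra.
  have [|e1 e2] := truncate_between uE Ep Eq px; first by rewrite mx -/M; lra.
  by exists x; rewrite /on_path e1 e2 mx; split; ring.
have [|x [px mx]] := @truncate q E (2 * M - mass E (coord p) + h) uE Eq; first by lra.
have [|e1 e2] := truncate_between uE Eq Ep px; first by rewrite mx minfC -/M; lra.
exists x; rewrite /on_path (pdistC p x) e2 (pdistC x q) e1 mx (pdistC q p).
split; first by ring.
by rewrite (pdist_l1 uE) // l1_mass -/M; ring.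
Qed.

(** Equality in the l1 triangle inequality forces equality in every coordinate, since no coordinate
    contributes a negative defect. *)
Lemma on_path_coord p q x v : on_path p q x ->
  Num.min (coord p v) (coord q v) <= coord x v <= Num.max (coord p v) (coord q v).
Proof.
have [E [uE hE]] := covers_seq [:: p; q; x].
have /= Ep := hE 0%N isT; have /= Eq := hE 1%N isT; have /= Ex := hE 2%N isT.
rewrite /on_path !(pdist_l1 uE) // => /eqP; rewrite -subr_eq0 -big_split -sumrB /=.
have D0 u : 0 <= `|coord p u - coord x u| + `|coord x u - coord q u|
    - `|coord p u - coord q u| by rewrite subr_ge0 ler_distD.
rewrite psumr_eq0; last by move=> u _; apply: D0.
move=> /allP h.
have : `|coord p v - coord x v| + `|coord x v - coord q v| = `|coord p v - coord q v|.
  case: (boolP (v \in E)) => vE; first by apply/eqP; rewrite -subr_eq0; apply: (h v vE).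
  have n0 y : covers E (coord y) -> coord y v = 0.
    by move=> Ey; apply/eqP; apply: contraNT vE => /Ey.
  by rewrite !n0 // subrr normr0 addr0.
have := ler_norm (coord p v - coord x v); have := ler_norm (coord x v - coord q v).
have := ler_normN (coord p v - coord x v); have := ler_normN (coord x v - coord q v).
case: (leP (coord p v) (coord q v)) => pq.
  by rewrite (distrC (coord p v) (coord q v)) (@ger0_norm _ (coord q v - _)); lra.
by rewrite (@ger0_norm _ (coord p v - coord q v)); lra.
Qed.

Lemma coord_on_path p q x :
  (forall v, Num.min (coord p v) (coord q v) <= coord x v <=
             Num.max (coord p v) (coord q v)) -> on_path p q x.
Proof.
move=> h; have [E [uE hE]] := covers_seq [:: p; q; x].
have /= Ep := hE 0%N isT; have /= Eq := hE 1%N isT; have /= Ex := hE 2%N isT.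
rewrite /on_path !(pdist_l1 uE) // -big_split; apply: eq_bigr => v _ /=.
move: (h v); case: (leP (coord p v) (coord q v)) => ? /andP[? ?].
  by rewrite !ler0_norm; lra.
by rewrite !ger0_norm; lra.
Qed.

Lemma pdist_coord p q v : `|coord p v - coord q v| <= pdist p q.
Proof.
have [E [uE hE]] := covers_seq [:: p; q].
have /= Ep := hE 0%N isT; have /= Eq := hE 1%N isT.
case: (boolP (v \in E)) => vE.
  rewrite (pdist_l1 uE) // (l1_split _ _ uE vE) lerDl.
  by apply: sumr_ge0.
have n0 y : covers E (coord y) -> coord y v = 0.
  by move=> Ey; apply/eqP; apply: contraNT vE => /Ey.
by rewrite !n0 // subrr normr0 pdist_ge0.
Qed.

(** All coordinates agree; those of a vertex are 0 or full, whereas an interior point has one that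
    is neither. *)
Lemma pdist_eq0_vertex p s : pdist p (Vertex s) = 0 -> p = Vertex s.
Proof.
move=> h; have e v : coord p v = coord (Vertex s) v.
  have := pdist_coord p (Vertex s) v; rewrite h normr_le0 subr_eq0.
  by move=> /eqP.
case: p h e => [x|u w t ad ht] _ e.
  congr Vertex; have sub a b : (forall v, vcoord a v = vcoord b v) -> a \in ancestors b.
    move=> /(_ a); rewrite vcoord_self; case: (eqVneq a r) => [-> _|ar].
      exact: root_ancestor.
    rewrite /(vcoord _); case: ifP => // _ /eqP.
    by rewrite gt_eqF // edge_len_gt0.
  by apply: (ancestors_anti (sub _ _ e)); apply: sub => v; apply/esym/e.
have [c [a [cr ca _ _ hc]]] := coord_inner r ad ht.
have ec := e c; rewrite hc eqxx in ec; case/andP: ca; rewrite ec /=.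
by case: (vcoord_cases r s c) => ->; rewrite ltxx.
Qed.

End Metric.

(** * Existence of phases and runs of DoubleCoverage *)

Section Existence.
Variables (R : realType) (T : weighted_tree R) (r : T) (k : nat).
Implicit Types (s : T) (p q x : Defs.point T) (P Q : 'I_k -> Defs.point T).

Lemma on_pathI p q x : pdist p x + pdist x q <= pdist p q -> on_path p q x.
Proof.
by move=> h; apply/eqP; rewrite eq_le h (pdist_triangle r).
Qed.

Lemma on_path_trans p q x y : on_path p q x -> on_path x q y -> on_path p q y.
Proof.
rewrite /on_path => h1 h2; apply: on_pathI.
by have := pdist_triangle r p x y; lra.
Qed.

(** Among the servers on the path from [P j] to [s], take those closest to [s], and of these the one
    of least index. *)
Lemma exists_unobstructed s P j :
  exists i, unobstructed s P i /\ on_path (P j) (Vertex s) (P i).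
Proof.
pose C i := `[< on_path (P j) (Vertex s) (P i) >].
have Cj : C j by apply/asboolP; rewrite /on_path (pdist_refl r) add0r.
have [m Cm mmin] := Order.TotalTheory.arg_minP (fun i => pdist (P i) (Vertex s)) Cj.
pose D i := C i && (pdist (P i) (Vertex s) == pdist (P m) (Vertex s)).
have Dm : D m by rewrite /D Cm eqxx.
have [i /andP[/asboolP Ci /eqP ei] imin] := arg_minnP (fun i : 'I_k => i : nat) Dm.
exists i; split=> // l li hl.
have Cl : C l by apply/asboolP; apply: on_path_trans hl.
have := mmin l Cl; rewrite -ei; move: (hl); rewrite /on_path => el lel.
have d0 : pdist (P i) (P l) = 0 by have := pdist_ge0 r (P i) (P l); lra.
split=> //; rewrite ltn_neqAle eq_sym; apply/andP; split; first exact: li.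
by apply: imin; rewrite /D Cl /= -ei -el d0 add0r.
Qed.

Lemma advance_exists s h P : 0 <= h ->
  (forall i, unobstructed s P i -> h <= pdist (P i) (Vertex s)) ->
  exists Q, advance s h P Q.
Proof.
move=> h0 hle; suff : forall i, exists q,
    (unobstructed s P i -> on_path (P i) (Vertex s) q /\ pdist (P i) q = h) /\
    (~ unobstructed s P i -> q = P i).
  by move=> /choice[Q hQ]; exists Q.
move=> i; have [u|nu] := pselect (unobstructed s P i); last by exists (P i).
have [|q hq] := @intermediate R T r (P i) (Vertex s) h; first by rewrite h0 hle.
by exists q.
Qed.

(** An obstructed server stands still, and a server on its path to [s] either stands still or moves
    on along this path, so the obstruction persists. *)
Lemma advance_unobstructed s h P Q i : 0 <= h -> advance s h P Q ->
  unobstructed s Q i -> unobstructed s P i.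
Proof.
move=> h0 adv uQ; apply: contrapT => nP.
have [_ /(_ nP) Qi] := adv i; apply: nP => j ji hj.
have [uj nuj] := adv j; have [u|nu] := pselect (unobstructed s P j); last first.
  by have := uQ j ji; rewrite Qi (nuj nu) => /(_ hj).
have [pj dj] := uj u.
have dij : pdist (P i) (Q j) = pdist (P i) (P j) + h /\ on_path (P i) (Vertex s) (Q j).
  move: hj pj; rewrite /on_path => hj pj.
  have := pdist_triangle r (P i) (P j) (Q j).
  have := pdist_triangle r (P i) (Q j) (Vertex s).
  by split; lra.
have := uQ j ji; rewrite Qi => /(_ dij.2)[d0 lt]; split=> //.
by have := pdist_ge0 r (P i) (P j); rewrite dij.1 in d0; lra.
Qed.

(** The right side of the bound is twice the distance from [P i] to the point where its path to [s]
    joins that of [P j]. A mover that has not reached this point cannot lie on the path of the other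
    one. *)
Lemma advance_keeps s h P Q : 0 <= h -> advance s h P Q ->
  (forall i j, unobstructed s P i -> unobstructed s P j -> i != j ->
     2 * h < pdist (P i) (Vertex s) + pdist (P i) (P j) - pdist (P j) (Vertex s)) ->
  forall i, unobstructed s P i -> unobstructed s Q i.
Proof.
move=> h0 adv hlt i ui j ji hj; have [/(_ ui)[pi di] _] := adv i.
have [uj nuj] := adv j; have [u|nu] := pselect (unobstructed s P j).
  have [pj dj] := uj u; move: hj pi pj; rewrite /on_path => hj pi pj.
  have := hlt j i u ui ji; rewrite (pdistC r (P j) (P i)).
  have := pdist_triangle r (P i) (Q i) (P j).
  have := pdist_triangle r (Q i) (Q j) (P j).
  by rewrite (pdistC r (Q j) (P j)); lra.
rewrite (nuj nu) in hj *.
have [d0 lt] : pdist (P i) (P j) = 0 /\ (i < j)%N.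
  by apply: ui => //; apply: on_path_trans hj.
split=> //; have := pdist_ge0 r (Q i) (P j).
have := pdist_triangle r (P i) (P j) (Vertex s).
by move: hj pi; rewrite /on_path; lra.
Qed.

(** By the two bounds, server [i] is exactly at the junction of the two paths and [j] has not passed
    it. The four-point condition turns this into an equality of distances. *)
Lemma meet_on_path s h P Q i j :
  on_path (P i) (Vertex s) (Q i) -> on_path (P j) (Vertex s) (Q j) ->
  pdist (P i) (Q i) = h -> pdist (P j) (Q j) = h ->
  pdist (P i) (Vertex s) + pdist (P i) (P j) - pdist (P j) (Vertex s) = 2 * h ->
  2 * h <= pdist (P j) (Vertex s) + pdist (P j) (P i) - pdist (P i) (Vertex s) ->
  on_path (Q j) (Vertex s) (Q i).
Proof.
rewrite /on_path => pi pj di dj e le.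
have := four_point r (Q i) (P j) (P i) (Vertex s).
have := four_point r (Q j) (Q i) (P j) (Vertex s).
rewrite (pdistC r (Q i) (P i)) (pdistC r (P j) (P i)) (pdistC r (Q i) (P j))
  (pdistC r (Q j) (P j)) in pi pj di dj e le *.
rewrite !le_max => /orP h1 /orP h2; apply: on_pathI.
by lra.
Qed.

Lemma phase_exists s P : 'I_k -> (forall i, P i <> Vertex s) ->
  exists h Q, [/\ dc_phase s h P Q, forall i, unobstructed s Q i -> unobstructed s P i &
    (exists i, Q i = Vertex s) \/
    (exists2 i, unobstructed s P i & ~ unobstructed s Q i)].
Proof.
move=> j0 ns; have [i0 [ui0 _]] := exists_unobstructed s P j0.
pose U i := `[< unobstructed s P i >].
(* Twice the time until a mover reaches [s] (equal indices) or its junction with another mover; the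
   phase lasts half the minimum. *)
pose F (ij : 'I_k * 'I_k) := if ij.1 == ij.2 then 2 * pdist (P ij.1) (Vertex s)
  else pdist (P ij.1) (Vertex s) + pdist (P ij.1) (P ij.2) - pdist (P ij.2) (Vertex s).
pose C (ij : 'I_k * 'I_k) := U ij.1 && U ij.2.
have C0 : C (i0, i0) by apply/andP; split; apply/asboolP.
have [[a b] /andP[/asboolP /= ua /asboolP /= ub] mmin] :=
  Order.TotalTheory.arg_minP F C0.
set h := F (a, b) / 2.
have hd i : unobstructed s P i -> h <= pdist (P i) (Vertex s).
  move=> ui; have := mmin (i, i); rewrite /C /= /U asboolT // => /(_ isT).
  by rewrite {2}/F /= eqxx -/(F (a, b)) /h; lra.
have hg i j : unobstructed s P i -> unobstructed s P j -> i != j ->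
    2 * h <= pdist (P i) (Vertex s) + pdist (P i) (P j) - pdist (P j) (Vertex s).
  move=> ui uj ij; have := mmin (i, j); rewrite /C /= /U !asboolT // => /(_ isT).
  by rewrite {2}/F /= (negbTE ij) /h; lra.
have h0 : 0 < h.
  rewrite divr_gt0 // /F /=; case: (eqVneq a b) => [_|ab].
    rewrite mulr_gt0 // lt_neqAle (pdist_ge0 r) andbT eq_sym.
    by apply/eqP => /(pdist_eq0_vertex r) /ns.
  (* A mover already at its junction with another one would lie on the path of that one. Both being
     unobstructed, they would be co-located and each have the smaller index. *)
  rewrite ltNge; apply/negP => le.
  have [||d0 ba] := ub a; [exact: ab|by apply: on_pathI; rewrite (pdistC r (P b)); lra|].
  have [||_ ab'] := ua b; [by rewrite eq_sym| |by move: ba ab'; lia].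
  apply: on_pathI; have := pdist_triangle r (P b) (P a) (Vertex s).
  by rewrite (pdistC r (P a) (P b)) d0; lra.
have [Q adv] := advance_exists (ltW h0) hd.
exists h, Q; split; last 1 first.
- have [[/(_ ua)[pa da] _] [/(_ ub)[pb db] _]] := (adv a, adv b).
  case: (eqVneq a b) => ab.
    left; exists a; apply: (pdist_eq0_vertex r).
    by move: pa; rewrite /on_path da /h /F /= -ab eqxx; lra.
  right; have hQ : on_path (Q b) (Vertex s) (Q a).
    apply: (meet_on_path pa pb da db).
      by rewrite /h /F /= (negbTE ab); lra.
    by apply: hg => //; rewrite eq_sym.
  have [uQb|] := pselect (unobstructed s Q b); last by exists b.
  exists a => // uQa; have [||d0 ba] := uQb a; [exact: ab|exact: hQ|].
  have [||_ ab'] := uQa b; [by rewrite eq_sym| |by move: ba ab'; lia].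
  apply: on_pathI; have := pdist_triangle r (Q b) (Q a) (Vertex s).
  by rewrite (pdistC r (Q a) (Q b)) d0; lra.
- split=> // h' P' /andP[h'0 h'h] adv' i; split.
    have [/= ui nui] := adv' i; have [u|nu] := pselect (unobstructed s P i).
      have [pi di] := ui u => e; move: pi; rewrite /on_path di e (pdist_refl r).
      by have := hd i u; lra.
    by rewrite (nui nu); apply: ns.
  split; first exact: advance_unobstructed adv'.
  apply: (advance_keeps h'0 adv') => a' b' ua' ub' ab'.
  by have := hg a' b' ua' ub' ab'; lra.
- by move=> i; apply: advance_unobstructed adv; apply: ltW.
Qed.

(** Induction on the number of unobstructed servers, which drops in each phase that does not reach
    [s]. *)
Lemma serve_exists s P : 'I_k -> exists Q c, dc_serve s P Q c.
Proof.
move=> i0; pose U P := [pred i : 'I_k | `[< unobstructed s P i >]].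
move: {2}#|U P|.+1 (ltnSn #|U P|) => n.
elim: n P => // n IH P hn.
have [[i hi]|hP] := pselect (exists i, P i = Vertex s).
  by exists P, 0; apply: dc_stop hi.
have [h [Q [ph sub dec]]] := phase_exists i0 (fun i e => hP (ex_intro _ i e)).
suff [P' [c hc]] : exists Q' c, dc_serve s Q Q' c.
  by eexists P', _; apply: dc_step ph hc.
case: dec => [[i hi]|[i ui nui]]; first by exists Q, 0; apply: dc_stop hi.
apply: IH; rewrite ltnS in hn; apply: leq_trans hn; apply: proper_card.
apply/properP; split.
  by apply/fintype.subsetP => j; rewrite !inE; apply: sub.
by exists i; rewrite inE //; apply/negP; rewrite inE.
Qed.

Lemma serve_at s P Q c : dc_serve s P Q c -> exists i, Q i = Vertex s.
Proof. by elim=> // P' i hi; exists i. Qed.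

Lemma run_exists P sigma : 'I_k -> exists c, dc_run P sigma c.
Proof.
move=> i0; elim: sigma P => [|[s d] sigma IH] P; first by exists 0; constructor.
have [Q [c hc]] := serve_exists s P i0; have [i hi] := serve_at hc.
have [c' hc'] := IH (relocate Q i (Vertex d)).
by exists (c + c'); apply: taxi_cons hc hi hc'.
Qed.

End Existence.

(** * Level coefficients, elevation and the cost of a matching *)

Section Potential.
Variables (R : realType) (T : weighted_tree R) (r : T) (k d : nat).
Hypotheses (k2 : (2 <= k)%N) (d1 : (1 <= d)%N).
Hypothesis depth_le : forall v, (level r v <= d)%N.
Implicit Types (s u v : T) (p q : Defs.point T) (P Q : 'I_k -> Defs.point T).
Implicit Types (O : 'I_k -> T).

Local Notation ancestors := (ancestors r).
Local Notation coord := (coord r).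
Local Notation level := (level r).

(* [height_coef j] is the weight b_l of the level l = d - j. *)
Fixpoint height_coef (j : nat) : R :=
  if j is j'.+1 then (k%:R - 1) * height_coef j' + k%:R else 1.

(** This is S: the edges at level 1 have coefficient [height_coef d.-1]. *)
Definition total_coef : R := k%:R * (height_coef d.-1 + 1).

Definition level_coef v : R := height_coef (d - level v).

Let kR2 : 2 <= k%:R :> R. Proof. by rewrite ler_nat. Qed.

Lemma height_coef_ge1 j : 1 <= height_coef j.
Proof.
elim: j => //= j IH; apply: (le_trans (le_trans _ kR2)); first by rewrite ler1n.
by rewrite lerDr mulr_ge0 // ?subr_ge0; [apply: le_trans kR2; rewrite ler1n|apply: le_trans IH].
Qed.

Lemma height_coef_mono i j : (i <= j)%N -> height_coef i <= height_coef j.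
Proof.
move=> /subnK <-; elim: (j - i)%N => // m IH /=; apply: le_trans IH _.
have h1 := height_coef_ge1 (m + i); have hk := kR2.
by move: (height_coef _) (k%:R : R) h1 hk => b c hb hc; nra.
Qed.

(** The recursion continued to level 0 gives [b_0 = S - b_1], which bounds all coefficients,
    including the one assigned to the root, by S - 1. *)
Lemma total_coefE : total_coef = height_coef d + height_coef d.-1.
Proof. by rewrite /total_coef; case: d d1 => //= n _; ring. Qed.

Lemma level_coef_ge1 v : 1 <= level_coef v.
Proof. exact: height_coef_ge1. Qed.

Lemma level_coef_le v : level_coef v <= total_coef - 1.
Proof.
rewrite total_coefE; have := height_coef_ge1 d.-1.
by have := @height_coef_mono (d - level v) d (leq_subr _ _); rewrite /level_coef; lra.
Qed.

Lemma level_coef_top v : (0 < level v)%N -> level_coef v <= height_coef d.-1.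
Proof. by move=> v0; apply: height_coef_mono; lia. Qed.

(** Half the difference between the upward cost [S - b_l] and the downward cost [b_l]. *)
Definition slope v : R := total_coef / 2 - level_coef v.

Definition elevation p : R := \sum_(v <- undup (support r p)) slope v * coord p v.

Lemma elevation_sum E p : uniq E -> covers E (coord p) ->
  elevation p = \sum_(v <- E) slope v * coord p v.
Proof.
move=> uE Ep; apply: sum_widen; rewrite ?undup_uniq // => v.
rewrite mulf_eq0 negb_or => /andP[_ pv]; split; last exact: Ep.
by rewrite mem_undup; apply: coord_covers.
Qed.

Lemma elevation_diff c p q :
  (forall v, coord p v != coord q v ->
     slope v * (coord q v - coord p v) <= c * `|coord p v - coord q v|) ->
  elevation q - elevation p <= c * pdist p q.
Proof.
move=> h; have [E [uE hE]] := covers_seq r [:: p; q].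
have /= Ep := hE 0%N isT; have /= Eq := hE 1%N isT.
rewrite (pdist_l1 (r := r) uE) // !(elevation_sum uE) // -sumrB mulr_sumr.
apply: ler_sum => v _; rewrite -mulrBr.
have [->|] := eqVneq (coord p v) (coord q v); last exact: h.
by rewrite !subrr normr0 !mulr0.
Qed.

Lemma slope_up c p q v : coord q v <= coord p v -> level_coef v <= c ->
  slope v * (coord q v - coord p v) <= (c - total_coef / 2) * `|coord p v - coord q v|.
Proof. by move=> qp vc; rewrite ger0_norm /slope ?subr_ge0 //; nra. Qed.

Lemma slope_down c p q v : coord p v <= coord q v -> c <= level_coef v ->
  slope v * (coord q v - coord p v) <= (total_coef / 2 - c) * `|coord p v - coord q v|.
Proof. by move=> qp vc; rewrite distrC ger0_norm /slope ?subr_ge0 //; nra. Qed.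

(** The slopes are at most S/2 - 1 in absolute value because the coefficients lie between 1 and S -
    1. *)
Lemma elevation_lipschitz p q :
  elevation q - elevation p <= (total_coef / 2 - 1) * pdist p q.
Proof.
apply: elevation_diff => v _; have := level_coef_ge1 v; have := level_coef_le v.
case: (leP (coord p v) (coord q v)) => pq le1 le2; first exact: slope_down.
apply: le_trans (slope_up (ltW pq) le1) _.
by rewrite ler_wpM2r //; lra.
Qed.

Definition match_cost p q : R :=
  total_coef / 2 * pdist p q + elevation p - elevation q.

Lemma match_cost_ge0 p q : 0 <= match_cost p q.
Proof.
rewrite /match_cost; have := elevation_lipschitz p q.
by have := pdist_ge0 r p q; nra.
Qed.

Lemma match_cost_refl p : match_cost p p = 0.
Proof. by rewrite /match_cost (pdist_refl r) mulr0 add0r subrr. Qed.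

Definition potential P O (pi : {perm 'I_k}) : R :=
  \sum_i match_cost (P i) (Vertex (O (pi i))).

(** * Which way the movers go during a phase *)

Lemma segment_of_vertex s p : (forall v, coord p v != 0 -> v \in ancestors s) ->
  segment r (coord (Vertex s)) (coord p).
Proof.
move=> h v; split.
  rewrite coord_ge0; case: (eqVneq (coord p v) 0) => [->|/h vs].
    exact: coord_ge0.
  by rewrite coord_vertex_in // coord_le.
move=> pv u uv nuv; rewrite (coord_full pv uv nuv) coord_vertex_in //.
exact: ancestors_trans uv (h v pv).
Qed.

Lemma on_path_decr p s q v : v \notin ancestors s -> on_path p (Vertex s) q ->
  coord q v <= coord p v.
Proof.
move=> vs /(on_path_coord r v); rewrite coord_vertex_out // => /andP[_].
by rewrite max_l ?coord_ge0.
Qed.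

(** A path to [s] first climbs and then descends along the root path of [s]. Were [q] still on an
    edge off this root path, [p] would be on it as well, hence full on [v] if [q] meets [v]. *)
Lemma descending_segment s p q v : on_path p (Vertex s) q ->
  coord p v < coord q v -> segment r (coord (Vertex s)) (coord q).
Proof.
move=> pq hlt; have vs : v \in ancestors s.
  by apply: contraT => vs; have := on_path_decr vs pq; rewrite leNgt hlt.
apply: segment_of_vertex => z qz; apply: contraLR hlt => zs.
have pz : coord p z != 0.
  have := on_path_decr zs pq; have := coord_ge0 r q z.
  by rewrite le_eqVlt eq_sym (negbTE qz) /= => *; rewrite gt_eqF //; lra.
rewrite -leNgt; have [->|qv] := eqVneq (coord q v) 0; first exact: coord_ge0.
case: (coord_chain qz qv) => [zv|vz].
  by rewrite (ancestors_trans zv vs) in zs.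
by rewrite (coord_full pz vz) ?coord_le //; apply: contraNneq zs => <-.
Qed.

Lemma segment_on_path s p q : segment r (coord (Vertex s)) (coord q) ->
  (forall v, v \in ancestors s -> coord p v <= coord q v) ->
  on_path p (Vertex s) q.
Proof.
move=> sq pq; apply: (coord_on_path (r := r)) => v; have [/andP[q0 qs] _] := sq v.
case: (boolP (v \in ancestors s)) => vs.
  rewrite ge_min pq // le_max qs orbT //.
rewrite coord_vertex_out // in qs *.
have -> : coord q v = 0 by lra.
by rewrite ge_min le_max lexx coord_ge0 orbT.
Qed.

(** If [p] were on the root path of [s], it would be comparable with [q]. If it left this root path
    before [v1], then [q] would lie on its path to [s]. *)
Lemma unobstructed_below s p q v1 :
  segment r (coord (Vertex s)) (coord q) -> coord q v1 != 0 ->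
  ~ on_path p (Vertex s) q -> ~ on_path q (Vertex s) p ->
  exists v, [/\ v \notin ancestors s, coord p v != 0 & v1 \in ancestors v].
Proof.
move=> sq qv1 npq nqp.
have v1s : v1 \in ancestors s.
  apply: contraNT qv1 => /coord_vertex_out e.
  by have [/andP[q0 +] _] := sq v1; rewrite e => q0'; apply/eqP/le_anti/andP.
have [[v pv vs]|hv] := pselect (exists2 v, coord p v != 0 & v \notin ancestors s); last first.
  have sp : segment r (coord (Vertex s)) (coord p).
    apply: segment_of_vertex => v pv; apply: contraT => vs.
    by case: hv; exists v.
  case: (segment_total sp sq) => h.
    by case: npq; apply: segment_on_path.
  by case: nqp; apply: segment_on_path.
exists v; split=> //; apply: contraT => v1v.
have p1 : coord p v1 = 0.
  apply/eqP; apply: contraT => pv1; case: (coord_chain pv pv1) => c.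
    by rewrite (ancestors_trans c v1s) in vs.
  by rewrite c in v1v.
have sm : segment r (coord (Vertex s)) (minf (coord (Vertex s)) (coord p)).
  exact: segment_min.
case: npq; apply: segment_on_path => // z zs.
have mz : minf (coord (Vertex s)) (coord p) z = coord p z.
  by rewrite /minf coord_vertex_in // min_r ?coord_le.
rewrite -mz; case: (segment_total sm sq) => // h.
have := h v1; rewrite /minf p1 min_r ?coord_ge0 // => q1.
by case/eqP: qv1; apply/le_anti; rewrite q1 coord_ge0.
Qed.

(** While one mover descends, every other one climbs strictly below it. At the end of the phase the
    movers may obstruct each other, so the argument looks at a moment shortly before. *)
Lemma phase_below s h P Q i j v1 v' : dc_phase s h P Q -> i != j ->
  unobstructed s P i -> unobstructed s P j ->
  coord (P j) v1 < coord (Q j) v1 -> coord (P i) v' != coord (Q i) v' ->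
  [/\ v1 \in ancestors v', v1 != v' & v' \notin ancestors s].
Proof.
move=> [h0 adv hph] ij ui uj lt1 ne'.
(* So small that at time [h - e] server [j] has already gained on [v1] and the coordinate of [i] at
   [v'] has already changed. *)
have [e [e0 eh e1 e2]] : exists e, [/\ 0 < e, e <= h,
    e < coord (Q j) v1 - coord (P j) v1 & e < `|coord (P i) v' - coord (Q i) v'|].
  pose m := Num.min h (Num.min (coord (Q j) v1 - coord (P j) v1)
                               `|coord (P i) v' - coord (Q i) v'|).
  have m0 : 0 < m by rewrite !lt_min h0 subr_gt0 lt1 normr_gt0 subr_eq0.
  have m1 : m <= h by rewrite /m ge_min lexx.
  have m2 : m <= coord (Q j) v1 - coord (P j) v1 by rewrite /m !ge_min lexx orbT.
  have m3 : m <= `|coord (P i) v' - coord (Q i) v'| by rewrite /m !ge_min lexx !orbT.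
  by exists (m / 2); split; lra.
(* Positions at time [h - e], chosen on the way to [Q l] so that they are within [e] of it. *)
have : forall l, exists q,
    (unobstructed s P l -> [/\ on_path (P l) (Vertex s) q, pdist (P l) q = h - e &
        pdist q (Q l) = e]) /\
    (~ unobstructed s P l -> q = P l).
  move=> l; have [u|nu] := pselect (unobstructed s P l); last by exists (P l).
  have [/(_ u)[pl dl] _] := adv l.
  have [|q [hq dq]] := @intermediate R T r (P l) (Q l) (h - e); first by rewrite dl; lra.
  exists q; split=> // _; have hq' := hq; rewrite /on_path dl dq in hq'.
  split=> //; last by lra.
  apply: (on_pathI r); rewrite dq; have := pdist_triangle r q (Q l) (Vertex s).
  by move: pl; rewrite /on_path dl; lra.
move=> /choice[P' hP'].
have adv' : advance s (h - e) P P'.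
  by move=> l; have [h1 h2] := hP' l; split=> // /h1[].
have uP' l : unobstructed s P l -> unobstructed s P' l.
  have h'h : 0 <= h - e < h by lra.
  by have [_ [_]] := hph _ _ h'h adv' l.
have [/(_ ui)[pi di ri] _] := hP' i; have [/(_ uj)[pj dj rj] _] := hP' j.
have lt1' : coord (P j) v1 < coord (P' j) v1.
  have := le_trans (ler_normN _) (pdist_coord r (P' j) (Q j) v1); rewrite rj.
  by clear - e1; lra.
have ne2 : coord (P i) v' != coord (P' i) v'.
  apply: contraTneq e2 => ->; rewrite -leNgt -ri; exact: pdist_coord.
have npq : ~ on_path (P' i) (Vertex s) (P' j) /\ ~ on_path (P' j) (Vertex s) (P' i).
  have half a b : unobstructed s P' a -> unobstructed s P' b -> a != b ->
      ~ on_path (P' a) (Vertex s) (P' b).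
    move=> ua ub ab hab; have [d0 lt] := ua b ltac:(by rewrite eq_sym) hab.
    have [|_ lt'] := ub a ab; last by have := ltn_trans lt lt'; rewrite ltnn.
    move: hab; rewrite /on_path (pdistC r (P' b) (P' a)) d0 => <-.
    by rewrite !add0r.
  by split; apply: half; rewrite ?(eq_sym j) //; apply: uP'.
have qv1 : coord (P' j) v1 != 0.
  by rewrite gt_eqF // (le_lt_trans _ lt1') // coord_ge0.
have [v [vs pv v1v]] :=
  unobstructed_below (descending_segment pj lt1') qv1 npq.1 npq.2.
have pv' : coord (P i) v != 0.
  have := on_path_decr vs pi; have := coord_ge0 r (P' i) v.
  by rewrite le_eqVlt eq_sym (negbTE pv) /= => *; rewrite gt_eqF //; lra.
(* Server [i] is on edge [v] at both times, so every edge strictly above [v] is full at both times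
   and cannot be [v']. *)
have vv' : v \in ancestors v'.
  have full : v' \in ancestors v -> v' = v.
    move=> v'v; apply/eqP; apply: contraNT ne2 => nv.
    by rewrite (coord_full pv v'v nv) (coord_full pv' v'v nv).
  have [q [qv qv']] : exists q, coord q v != 0 /\ coord q v' != 0.
    have [e0'|] := eqVneq (coord (P i) v') 0; last by exists (P i).
    by exists (P' i); rewrite pv; split=> //; rewrite -e0' eq_sym.
  by case: (coord_chain qv qv') => // /full ->; apply: ancestors_refl.
have v's : v' \notin ancestors s.
  by apply: contra vs => /(ancestors_trans vv').
split=> //; first exact: ancestors_trans v1v vv'.
apply: contraNneq v's => <-; apply: contraT => v1s.
by have := on_path_decr v1s pj; rewrite leNgt lt1'.
Qed.

Lemma changed_neq_root p q v : coord p v != coord q v -> v != r.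
Proof.
apply: contraNneq => ->; have e0 : edge_len r r = 0 by rewrite /edge_len eqxx.
have z x : coord x r = 0.
  by apply/le_anti; rewrite coord_ge0 -[X in _ <= X]e0 coord_le.
by rewrite !z.
Qed.

Lemma pdist_gt0_changed p q : 0 < pdist p q -> exists v, coord p v != coord q v.
Proof.
have [E [uE hE]] := covers_seq r [:: p; q].
have /= Ep := hE 0%N isT; have /= Eq := hE 1%N isT.
rewrite (pdist_l1 (r := r) uE) // => h; apply: contrapT => /forallNP no.
move: h; rewrite /l1 big1 ?ltxx // => v _.
by have /negP/negPn/eqP-> := no v; rewrite subrr normr0.
Qed.

(** The summand [h] is the cost of a mover. The right side offsets [S/2] times the change of the
    matched distances: one of the n movers approaches its partner by [h], the other n - 1 recede by
    at most [h]. *)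
Lemma phase_drift s h P Q : dc_phase s h P Q -> (exists i, unobstructed s P i) ->
  \sum_(i | `[< unobstructed s P i >]) (elevation (Q i) - elevation (P i) + h)
    <= total_coef / 2 * (2 - #|[pred i | `[< unobstructed s P i >]]|%:R) * h.
Proof.
move=> ph [i0 ui0]; have [h0 adv hph] := ph.
set U := [pred i | `[< unobstructed s P i >]].
have hU i : i \in U -> unobstructed s P i by rewrite inE.
have hadv i : unobstructed s P i -> on_path (P i) (Vertex s) (Q i) /\ pdist (P i) (Q i) = h.
  by move=> ui; have [/(_ ui)] := adv i.
have up i v c : unobstructed s P i -> coord (Q i) v <= coord (P i) v ->
    level_coef v <= c ->
    slope v * (coord (Q i) v - coord (P i) v) <=
    (c - total_coef / 2) * `|coord (P i) v - coord (Q i) v|.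
  by move=> _; apply: slope_up.
have nk : #|U|%:R <= k%:R :> R by rewrite ler_nat -[X in (_ <= X)%N]card_ord max_card.
set S := total_coef; set n := #|U|%:R.
have [[j [uj [v0 lt0]]]|none] := pselect (exists j, unobstructed s P j /\
    exists v, coord (P j) v < coord (Q j) v); last first.
  apply: (@le_trans _ _ (\sum_(i | i \in U) ((height_coef d.-1 - S / 2) * h + h))).
    apply: ler_sum => i /hU ui; rewrite lerD2r; have [pi di] := hadv i ui.
    rewrite -{1}di; apply: elevation_diff => v ne.
    apply: up => //; last first.
      exact/level_coef_top/level_gt0/(changed_neq_root ne).
    by rewrite leNgt; apply/negP => lt; apply: none; exists i; split=> //; exists v.
  rewrite sumr_const -/n -mulr_natl -/n /S /total_coef.
  have := height_coef_ge1 d.-1; move: (height_coef _) => b b1.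
  (* All movers climb; the value [S = k (b_1 + 1)] is tight when all k servers move. *)
  rewrite -subr_ge0 [leRHS](_ : _ = (k%:R - n) * (b + 1) * h); last by field.
  by rewrite !mulr_ge0 ?subr_ge0 //; [lra|exact: ltW].
(* The lowest edge descended by [j]: its coefficient is the least among them, and all other movers
   are below it. *)
have [v1 lt1 max1] : exists2 v1, coord (P j) v1 < coord (Q j) v1 &
    forall v, coord (P j) v < coord (Q j) v -> (level v <= level v1)%N.
  pose C m := `[< exists2 v, coord (P j) v < coord (Q j) v & level v = m >].
  have exC : exists m, C m by exists (level v0); apply/asboolP; exists v0.
  have leC m : C m -> (m <= d)%N by move=> /asboolP[v _ <-].
  case: (ex_maxnP exC leC) => m /asboolP[v1 lt1 <-] max; exists v1 => // v ltv.
  by apply: max; apply/asboolP; exists v.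
pose b := level_coef v1; pose b' := height_coef (d - (level v1).+1).
have b1 : 1 <= b by apply: level_coef_ge1.
have b1' : 1 <= b' by apply: height_coef_ge1.
have hj : elevation (Q j) - elevation (P j) <= (S / 2 - b) * h.
  have [pj dj] := hadv j uj; rewrite -{1}dj; apply: elevation_diff => v ne.
  case: (ltP (coord (P j) v) (coord (Q j) v)) => c.
    apply: slope_down; first exact: ltW.
    by apply/height_coef_mono/leq_sub2l/max1.
  (* Where [j] still climbs the bound holds as well, since two coefficients add up to at most
     [2 b_1 <= S]. *)
  apply: le_trans (up j v _ uj c (lexx _)) _; rewrite ler_wpM2r //.
  have vtop := level_coef_top (level_gt0 (changed_neq_root ne)).
  have v1top : b <= height_coef d.-1.
    apply/level_coef_top/level_gt0/(@changed_neq_root (P j) (Q j)).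
    by rewrite lt_eqF.
  have := height_coef_ge1 d.-1; move: vtop v1top kR2; rewrite /S /total_coef.
  move: (height_coef d.-1) (k%:R : R) (level_coef v) => x y z *; nra.
have hi i : unobstructed s P i -> i != j ->
    elevation (Q i) - elevation (P i) <= (b' - S / 2) * h.
  move=> ui ij; have [pi di] := hadv i ui; rewrite -{1}di.
  apply: elevation_diff => v ne.
  have [v1v nv vs] := phase_below ph ij ui uj lt1 ne.
  apply: up => //; first exact: on_path_decr vs pi.
  by apply/height_coef_mono/leq_sub2l/ancestors_level.
have jU : j \in U by rewrite inE.
rewrite (bigD1 j) //=.
apply: (@le_trans _ _ ((S / 2 - b) * h + h +
    \sum_(i | (i \in U) && (i != j)) ((b' - S / 2) * h + h))).
  apply: lerD; first by rewrite lerD2r.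
  by apply: ler_sum => i /andP[/hU ui ij]; rewrite lerD2r hi.
rewrite sumr_const -[X in _ + X <= _]mulr_natl.
set m := (X in _ + X * _ <= _); have nm : n = m + 1.
  by rewrite /n /m (cardD1x jU) natrD addrC.
(* The recursion needs [v1] to be above level d. A second mover ensures this, as it moves on an edge
   below [v1]. *)
have mk : (m = 0 \/ b = (k%:R - 1) * b' + k%:R) /\ 0 <= m.
  split; last exact: ler0n.
  have [->|] := eqVneq m 0; [by left|rewrite pnatr_eq0 -lt0n => /card_gt0P[i /andP[/hU ui ij]]].
  right.
  have [_ di] := hadv i ui; have [|v ne] := @pdist_gt0_changed (P i) (Q i).
    by rewrite di.
  have [v1v nv _] := phase_below ph ij ui uj lt1 ne.
  by rewrite /b /level_coef -subnSK // (leq_trans (ancestors_level v1v nv)).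
(* As m + 1 <= k, the coefficient [b] pays for the m climbers and for the cost of all m + 1
   movers. *)
have key : m * b' + m + 1 <= b.
  case: mk => -[->|->] m0; first by rewrite mul0r !add0r.
  move: nk; rewrite -/n nm; move: (k%:R : R) => K nk.
  nra.
rewrite nm -subr_ge0 [leRHS](_ : _ = (b - (m * b' + m + 1)) * h); last by field.
by rewrite mulr_ge0 ?subr_ge0 // ltW.
Qed.

(** * The potential along a run *)

(** Swap the partners of [i] and [j]. The elevations add up to the same total for every matching,
    and the distances do not increase by the triangle inequality through [P i]. *)
Lemma rematch s P O (pi : {perm 'I_k}) i j : on_path (P j) (Vertex s) (P i) ->
  O (pi j) = s ->
  exists pi' : {perm 'I_k}, pi' i = pi j /\ potential P O pi' <= potential P O pi.
Proof.
move=> ij Ojs; have [<-|nij] := eqVneq j i; first by exists pi.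
exists (tperm i j * pi)%g; split; first by rewrite permM tpermL.
rewrite /potential (bigD1 i) // (bigD1 j) //= [leRHS](bigD1 i) // [in leRHS](bigD1 j) //=.
rewrite !addrA; apply: lerD; last first.
  apply: ler_sum => l /andP[li lj]; rewrite permM tpermD //; by rewrite eq_sym.
rewrite !permM tpermL tpermR Ojs /match_cost.
have := pdist_triangle r (P j) (P i) (Vertex (O (pi i))).
move: ij; rewrite /on_path.
have : 1 <= total_coef by have := level_coef_le r; have := level_coef_ge1 r; lra.
move: total_coef => S S1 pij tri.
nra.
Qed.

Lemma phase_potential s h P Q O (pi : {perm 'I_k}) m : dc_phase s h P Q ->
  unobstructed s P m -> O (pi m) = s ->
  potential Q O pi + \sum_i pdist (P i) (Q i) <= potential P O pi.
Proof.
move=> ph um Om; have [h0 adv _] := ph.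
have := phase_drift ph (ex_intro _ m um); set U := [pred i | _] => drift.
have mU : m \in U by rewrite inE.
(* Bound for the change of one matching cost plus the movement cost: only [m] is known to approach
   its partner. *)
pose G i := total_coef / 2 * (if i == m then - h else h)
  + (elevation (Q i) - elevation (P i) + h).
have bnd i : match_cost (Q i) (Vertex (O (pi i))) + pdist (P i) (Q i)
    - match_cost (P i) (Vertex (O (pi i))) <=
    if i \in U then G i else 0.
  rewrite inE /G; case: asboolP => [u|nu]; last first.
    by have [_ /(_ nu) ->] := adv i; rewrite (pdist_refl r) addr0 subrr.
  have [/(_ u)[pi' di] _] := adv i; rewrite /match_cost di.
  have S0 : 0 <= total_coef / 2 by have := level_coef_le r; have := level_coef_ge1 r; lra.
  suff : pdist (Q i) (Vertex (O (pi i))) - pdist (P i) (Vertex (O (pi i))) <=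
      (if i == m then - h else h).
    by move=> /(ler_wpM2l S0); rewrite mulrBr; lra.
  case: eqVneq => [->|_]; last first.
    have := pdist_triangle r (Q i) (P i) (Vertex (O (pi i))).
    by rewrite (pdistC r (Q i) (P i)) di; lra.
  have [/(_ um)[pm dm] _] := adv m.
  by move: pm; rewrite /on_path Om dm; lra.
rewrite /potential -subr_le0 -big_split -sumrB /=.
apply: (@le_trans _ _ (\sum_i (if i \in U then G i else 0))).
  by apply: ler_sum => i _; apply: bnd.
rewrite -big_mkcond big_split /= (bigD1 m) //= eqxx.
have -> : \sum_(i in U | i != m) total_coef / 2 * (if i == m then - h else h) =
    total_coef / 2 * h * (#|U|%:R - 1).
  rewrite (eq_bigr (fun=> total_coef / 2 * h)); last by move=> i /andP[_ /negbTE->].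
  rewrite sumr_const -[LHS]mulr_natr; congr (_ * _).
  by rewrite (cardD1x mU) natrD addrC addKr.
move: drift; rewrite (eq_bigl (fun i => i \in U)); last by move=> i; rewrite inE.
by lra.
Qed.

(** Before each phase the request is rematched to an unobstructed server on the way from its current
    partner. *)
Lemma serve_potential s P Q c O (pi : {perm 'I_k}) i : dc_serve s P Q c ->
  O i = s -> exists pi' : {perm 'I_k},
  potential Q O pi' + c <= potential P O pi.
Proof.
move=> hs Ois; elim: hs pi => [P' j _ |h P' Q' P'' c' ph _ IH] pi.
  by exists pi; rewrite addr0.
have [m [um hm]] := exists_unobstructed r s P' ((pi^-1)%g i).
have Oi : O (pi ((pi^-1)%g i)) = s by rewrite permKV.
have [pi1 [pi1m le1]] := rematch hm Oi.
have [pi2 le2] := IH pi1; exists pi2.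
have Om : O (pi1 m) = s by rewrite pi1m permKV.
by have := phase_potential ph um Om; lra.
Qed.

(** Once the two relocated servers are matched with each other, their cost after the relocation is
    0. *)
Lemma relocate_potential s x P O (pi : {perm 'I_k}) i j : P i = Vertex s -> O j = s ->
  exists pi' : {perm 'I_k},
  potential (relocate P i (Vertex x)) (relocate O j x) pi' <= potential P O pi.
Proof.
move=> Pi Oj; set l := (pi^-1)%g j.
have hl : on_path (P l) (Vertex s) (P i) by rewrite /on_path Pi (pdist_refl r) addr0.
have Ol : O (pi l) = s by rewrite permKV.
have [pi' [pi'i le']] := rematch hl Ol; exists pi'; apply: le_trans le'.
rewrite /l permKV in pi'i; apply: ler_sum => a _; rewrite /relocate.
case: (eqVneq a i) => [->|ai]; first by rewrite pi'i eqxx match_cost_refl match_cost_ge0.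
by rewrite -pi'i (inj_eq perm_inj) (negbTE ai).
Qed.

(** Per unit moved, the distance term grows by at most S/2 and the elevation term by at most S/2 -
    1. *)
Lemma offline_potential P O O' (pi : {perm 'I_k}) :
  potential P O' pi <= potential P O pi +
    (total_coef - 1) * \sum_i dist (O i) (O' i).
Proof.
rewrite [X in _ * X](reindex_inj (@perm_inj _ pi)) /= mulr_sumr -big_split /=.
apply: ler_sum => i _; rewrite /match_cost.
have := elevation_lipschitz (Vertex (O' (pi i))) (Vertex (O (pi i))).
have := pdist_triangle r (P i) (Vertex (O (pi i))) (Vertex (O' (pi i))).
rewrite (pdistC r (Vertex (O' _))).
have : 1 <= total_coef by have := level_coef_le r; have := level_coef_ge1 r; lra.
rewrite -/(pdist (Vertex (O (pi i))) (Vertex (O' (pi i)))).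
move: total_coef (pdist _ _) (pdist _ _) (pdist _ _) => S a b c S1 tri lip.
nra.
Qed.

Lemma run_potential sigma P O (pi : {perm 'I_k}) x y :
  dc_run P sigma x -> taxi_run id (@offline_serve R T k) O sigma y ->
  x <= (total_coef - 1) * y + potential P O pi.
Proof.
elim: sigma P O pi x y => [|[s e] sigma IH] P O pi x y hx hy.
  inversion hx; inversion hy; subst.
  by rewrite mulr0 add0r; apply: sumr_ge0 => i _; apply: match_cost_ge0.
inversion hx as [|P1 Q i s1 d1' sig1 c c' hs Qi hrun]; subst.
inversion hy as [|O1 O' j s2 d2 sig2 a a' ho Oj hrun']; subst.
have [pi1 le1] := serve_potential pi hs (erefl (O' j)).
have [pi2 le2] := relocate_potential e pi1 Qi (erefl (O' j)).
have le3 := IH _ _ pi2 _ _ hrun hrun'.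
have le4 := offline_potential P O O' pi.
by rewrite ho; lra.
Qed.

Lemma offline_exists (O : 'I_k -> T) sigma :
  exists y, taxi_run id (@offline_serve R T k) O sigma y.
Proof.
have k0 : (0 < k)%N by apply: ltn_trans k2.
elim: sigma O => [|[s e] sigma IH] O; first by exists 0; constructor.
pose O' := relocate O (Ordinal k0) s.
have [y hy] := IH (relocate O' (Ordinal k0) e).
exists (\sum_i dist (O i) (O' i) + y); by apply: taxi_cons hy => //; rewrite /O' /relocate eqxx.
Qed.

(** Both sides start in the same configuration, so the identity matching has potential 0 and no
    additive constant arises. *)
Lemma run_le_OPT (C0 : 'I_k -> T) sigma x :
  dc_run (fun i => Vertex (C0 i)) sigma x ->
  x <= (total_coef - 1) * OPT C0 sigma.
Proof.
move=> hx; have S1 : 0 < total_coef - 1.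
  by have := level_coef_le r; have := level_coef_ge1 r; lra.
rewrite -ler_pdivrMl // mulrC; apply: lb_le_inf; first exact: offline_exists.
move=> y hy; rewrite ler_pdivrMr // mulrC.
have := run_potential 1%g hx hy; rewrite /potential big1 ?addr0 // => i _.
by rewrite perm1 match_cost_refl.
Qed.

End Potential.

(** * Competitiveness and closed forms of the ratio *)

Lemma DC_competitive_total (R : realType) (k d : nat) : (2 <= k)%N -> (1 <= d)%N ->
  DC_competitive k (@combinatorial_depth R d) (total_coef R k d - 1).
Proof.
move=> k2 d1 T [r hr] C0; exists 0 => sigma /=; split.
  by apply: (run_exists r); apply: (@Ordinal k 0); apply: ltn_trans k2.
move=> x hx; rewrite addr0; apply: (@run_le_OPT R T r k d k2 d1) hx.
by move=> v; have [p [hp hl hs]] := hr v; apply: walk_to_root_size hp hl hs.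
Qed.

Theorem theorem11 (R : realType) (d : nat) (hd : (1 <= d)%N) :
  DC_competitive 2 (@combinatorial_depth R d) (4 * d%:R - 1) /\
  (forall k : nat, (3 <= k)%N ->
     DC_competitive k (@combinatorial_depth R d)
       ((2 * k%:R * (k%:R - 1) ^+ d - 3 * k%:R + 2) / (k%:R - 2))).
Proof.
split=> [|k k3].
  suff -> : 4 * d%:R - 1 = total_coef R 2 d - 1 by apply: DC_competitive_total.
  rewrite /total_coef; case: d hd => // n _ /=; congr (_ - 1).
  (* For k = 2 the coefficient grows by 2 per level, so S grows by 4. *)
  elim: n => [|n IH] /=; first by ring.
  by rewrite -[n.+2%:R]natr1 mulrDr IH; ring.
suff -> : (2 * k%:R * (k%:R - 1) ^+ d - 3 * k%:R + 2) / (k%:R - 2) = total_coef R k d - 1.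
  by apply: DC_competitive_total => //; apply: ltn_trans k3.
have k0 : k%:R - 2 != 0 :> R by rewrite subr_eq0 eqr_nat; case: k k3 => [|[|[]]].
rewrite /total_coef; case: d hd => // n _ /=.
elim: n => [|n IH] /=; first by field.
(* The ratio [S - 1] satisfies the affine recurrence [x -> (k - 1) x + 3 k - 2] in the depth, which
   the closed form also satisfies. *)
have -> : k%:R * ((k%:R - 1) * height_coef R k n + k%:R + 1) - 1 =
  (k%:R - 1) * (k%:R * (height_coef R k n + 1) - 1) + 3 * k%:R - 2 :> R by ring.
by rewrite -IH exprS; field.
Qed.
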